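(* There exist absolute constants $C,k>0$ such that the following holds for every prime power $q$. Let $A$ and $X$ be nonempty subsets of $\mathbb{F}_q^*$ and let $K\ge 1$ be a real number such that $C(\log q)^k K^{1505}\le |X|$. Suppose \[ \sum_{\xi\in X}E(A,\xi A)\ \ge\ \frac{|A|^3|X|}{K}. \] Then there exist an element $\bar a\in A$, a subfield $F\subseteq\mathbb{F}_q$, and an $F$-vector space $V\subseteq\mathbb{F}_q$ such that \[ |V\cap(A-\bar a)|\ \ge\ C^{-1}(\log q)^{-k}\max\{K^{-704}|V|,\ K^{-85}|A|\}. \] Further (for the same $\bar a$, $F$, $V$), there is an element $x_0\in X$ and subsets $A_1\subseteq A-\bar a$ and $X'\subseteq x_0^{-1}X$ such that $F$ is the subfield generated by $X'$, $V$ is the $F$-vector space generated by $A_1$, and \[ |A_1|\ge C^{-1}(\log q)^{-k}K^{-85}|A|\quad\text{and}\quad |X'|\ge C^{-1}(\log q)^{-k}K^{-5}|X|. \] Moreover, if $E(A,\xi A)\ge |A|^3/K$ for all $\xi\in X$, then the same conclusions hold with the stronger bound $|X'|\ge C^{-1}(\log q)^{-k}K^{-4}|X|$, and under only the weaker requirement $C(\log q)^kK^{1504}\le |X|$ in place of $C(\log q)^kK^{1505}\le|X|$.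
   Context: $\mathbb{F}_q$ is the finite field with $q$ elements, $\mathbb{F}_q^*=\mathbb{F}_q\setminus\{0\}$. For $A\subseteq\mathbb{F}_q$ and $\xi\in\mathbb{F}_q^*$, $E(A,\xi A)=|\{(a_1,a_2,a_3,a_4)\in A^4: a_1-a_2=\xi(a_3-a_4)\}|$. Also $A-\bar a=\{a-\bar a:a\in A\}$ and $x_0^{-1}X=\{x_0^{-1}x:x\in X\}$. *)

(* Defs.v *)
From HB Require Import structures.
From mathcomp Require Import all_boot all_order all_algebra.
From mathcomp Require Import reals exp.

Set Implicit Arguments.
Unset Strict Implicit.
Unset Printing Implicit Defensive.

Import Order.TTheory GRing.Theory Num.Theory.
Local Open Scope ring_scope.

(* E(A, xi A), counted by quadruples of A. *)
Definition energy (L : finFieldType) (A : {set L}) (xi : L) : nat :=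
  #|[set t : L * L * L * L |
     let: (a1, a2, a3, a4) := t in
     [&& a1 \in A, a2 \in A, a3 \in A, a4 \in A
       & a1 - a2 == xi * (a3 - a4)]]|.

Definition translate (L : finFieldType) (A : {set L}) (b : L) : {set L} :=
  [set a - b | a in A].

Definition dilate (L : finFieldType) (c : L) (X : {set L}) : {set L} :=
  [set c * x | x in X].

Definition is_subfield (L : finFieldType) (F : {set L}) : Prop :=
  GRing.divring_closed F.

(* V is an F-linear subspace of L; meant for F a subfield of L. *)
Definition is_subspace (L : finFieldType) (F V : {set L}) : Prop :=
  GRing.zmod_closed V /\ {in F & V, forall c v, c * v \in V}.

Definition subfield_generated (L : finFieldType) (X F : {set L}) : Prop :=
  [/\ is_subfield F, X \subset F
    & forall G : {set L}, is_subfield G -> X \subset G -> F \subset G].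

Definition subspace_generated (L : finFieldType) (F A V : {set L}) : Prop :=
  [/\ is_subspace F V, A \subset V
    & forall W : {set L}, is_subspace F W -> A \subset W -> V \subset W].

(* The common conclusion of both cases, up to the loss factor
   M = C * (log q) ^ k and the exponent e of K in the bound on |X'|. *)
Definition subspace_structure (R : realType) (L : finFieldType)
    (A X : {set L}) (K M : R) (e : nat) : Prop :=
  exists abar : L, exists F V : {set L},
    [/\ abar \in A,
        is_subfield F,
        is_subspace F V,
        #|V :&: translate A abar|%:R
          >= M^-1 * Num.max (K ^- 704 * #|V|%:R) (K ^- 85 * #|A|%:R)
      & exists x0 : L, exists A1 X' : {set L},
          [/\ x0 \in X,
              A1 \subset translate A abar /\ X' \subset dilate x0^-1 X,
              subfield_generated X' F /\ subspace_generated F A1 V,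
              #|A1|%:R >= M^-1 * K ^- 85 * #|A|%:R
            & #|X'|%:R >= M^-1 * K ^- e * #|X|%:R]].

(* Main.v *)
(* Large energy gives, for each xi in X, a subset R_xi of A of size >> |A|/K with
   |R_xi - R_xi| << K^3 |A| and a translate of xi R_xi inside A.  By
   Cauchy-Schwarz one R = R_x0 serves for all x in a large X' in x0^-1 X, in the
   sense that adding x R to any set costs no more than adding R, up to a power
   of K.  Put D = R - R and call v a pivot if (x - x')v lies in D for more than
   K^C |X'| pairs (x, x') of X'.  A pigeonhole argument shows that the pivots are
   closed under addition and under multiplication by X', so they form a vector
   space over the field F generated by X'.  Counting the collisions of
   (r, x) |-> r + x v shows that there are at most K^C' |R| pivots, and averaging
   gives an element b of R such that r - b is a pivot for a large proportion of
   the r in R.  These differences are A1, and their F-span V consists of pivots. *)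
Require Import Defs.
From HB Require Import structures.
From mathcomp Require Import all_boot all_order all_algebra.
From mathcomp Require Import reals exp.
From mathcomp Require Import boolp zify ring lra.

Set Implicit Arguments.
Unset Strict Implicit.
Unset Printing Implicit Defensive.

Import Order.TTheory GRing.Theory Num.Theory.
Local Open Scope ring_scope.

(** The obstacle is that each closure step on pivots loses powers of [tau] and [kappa], while
    generating a field and a span takes unboundedly many steps, so a naive notion of pivot would
    decay. The remedy is a gap. The threshold for pivots is linear in the size of the scalar set,
    just high enough to outweigh degenerate pairs; yet crossing it forces a number of pairs
    quadratic in that size, up to fixed losses. When the scalar set is large against these losses,
    what survives one step is again above the threshold, so closure is exact. Addition is the
    costliest step and dictates the lower bound on the scalar set. With [tau] of order k^10 and
    [kappa] of order k^4 it amounts to k^1080, which fits under the exponent 1504; likewise 11 and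
    182 fit under 85 and 704. The exponents for X' carry no slack: 4 comes from Cauchy-Schwarz, and
    one more from replacing an average energy by a pointwise one. No logarithm is lost: log q only
    absorbs an absolute constant. *)

(** * Averaging, Cauchy-Schwarz and collision counts *)

Lemma sum_sqr_le (I : finType) (P : {set I}) (n : I -> nat) :
  ((\sum_(i in P) n i) ^ 2 <= #|P| * \sum_(i in P) n i ^ 2)%N.
Proof.
have -> : ((\sum_(i in P) n i) ^ 2 =
           \sum_(i in P) \sum_(j in P) n i * n j)%N.
  by rewrite -mulnn big_distrl /=; apply: eq_bigr => i _; rewrite big_distrr.
rewrite -(leq_pmul2l (isT : 0 < 2)%N).
have -> : (2 * (#|P| * \sum_(i in P) n i ^ 2) =
   \sum_(i in P) \sum_(j in P) (n i ^ 2 + n j ^ 2))%N.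
  have -> : (\sum_(i in P) \sum_(j in P) (n i ^ 2 + n j ^ 2) =
     \sum_(i in P) (#|P| * n i ^ 2 + \sum_(j in P) n j ^ 2))%N.
    by apply: eq_bigr => i _; rewrite big_split /= sum_nat_const.
  by rewrite big_split /= sum_nat_const -big_distrr /= mul2n -addnn.
rewrite big_distrr leq_sum // => i _; rewrite big_distrr leq_sum // => j _.
exact: nat_Cauchy.
Qed.

Lemma avg_le (I : finType) (P : {set I}) (f : I -> nat) (N b : nat) :
  (0 < #|P| -> #|P| * N <= b * \sum_(i in P) f i ->
   exists2 i, i \in P & N <= b * f i)%N.
Proof.
move=> P0 h; case: (boolP [exists i in P, N <= b * f i])%N.
  by move=> /existsP[i /andP[iP hi]]; exists i.
rewrite negb_exists => /forallP hn; exfalso.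
have : (\sum_(i in P) (b * f i).+1 <= \sum_(i in P) N)%N.
  apply: leq_sum => i iP; have := hn i; rewrite iP /= -ltnNge //.
rewrite sum_nat_const.
have -> : (\sum_(i in P) (b * f i).+1 = b * (\sum_(i in P) f i) + #|P|)%N.
  rewrite big_distrr -sum1_card -big_split /=.
  by apply: eq_bigr => i _; rewrite addn1.
lia.
Qed.

(** Points below the threshold account for at most half of the guaranteed total, so the others, each
    worth at most [B], must be numerous. *)
Lemma popular_le (I : finType) (P : {set I}) (f : I -> nat) (B a : nat) :
  (0 < B -> (forall i, i \in P -> f i <= B) ->
   #|P| * B <= a * \sum_(i in P) f i ->
   #|P| <= 2 * a * #|[set i in P | B <= 2 * a * f i]|)%N.
Proof.
move=> B0 fB h; set G := [set i in P | _].
have hs : (2 * a * \sum_(i in P) f i <= 2 * a * B * #|G| + #|P| * B)%N.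
  rewrite big_distrr /= -sum_nat_const.
  have -> : (2 * a * B * #|G| =
             \sum_(i in P) (if i \in G then 2 * a * B else 0))%N.
    rewrite -big_mkcondr /= sum_nat_cond_const mulnC; congr (_ * _)%N.
    by apply: eq_card => i; rewrite !inE; case: (i \in P).
  rewrite -big_split /=; apply: leq_sum => i iP.
  rewrite inE iP /=; case: ifP => hi; last by rewrite add0n ltnW // ltnNge hi.
  by rewrite (leq_trans _ (leq_addr _ _)) // leq_mul2l fB // orbT.
rewrite -(leq_pmul2r B0); nia.
Qed.

(** Cauchy-Schwarz on the fibres of [g] over [W] yields many collisions. Since each [g s] is
    injective, a collision is determined by its two elements of [S] and its first element of [U], so
    one pair of [S] accounts for at most [#|U|] of them. This is the count behind [hits_ge],
    [near_hits] and [pivots_base]. *)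
Lemma near_pairs (T I V : finType) (S : {set T}) (U : {set I}) (W : {set V})
    (g : T -> I -> V) :
  (forall s i, s \in S -> i \in U -> g s i \in W) ->
  (forall s, injective (g s)) ->
  (#|S| ^ 2 * #|U| <= #|W| * #|[set p in setX S S |
      [exists i in U, exists j in U, g p.1 i == g p.2 j]]|)%N.
Proof.
move=> gW g_inj; set G := [set p in _ | _].
have [->|/set0Pn[i0 i0U]] := eqVneq U set0; first by rewrite cards0 muln0.
pose fib w := [set q in setX S U | g q.1 q.2 == w].
have h1 : (\sum_(w in W) #|fib w| = #|S| * #|U|)%N.
  rewrite -cardsX -sum1_card.
  rewrite (partition_big (fun q : T * I => g q.1 q.2) (mem W)) /=.
    by apply: eq_bigr => w _; rewrite -sum1_card; apply: eq_bigl => q; rewrite !inE.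
  by move=> [s i]; rewrite inE /= => /andP[sS iU]; exact: gW.
have h2 : (\sum_(w in W) #|fib w| ^ 2 <= #|G| * #|U|)%N.
  pose C := [set c in setX (setX S U) (setX S U) |
               g c.1.1 c.1.2 == g c.2.1 c.2.2].
  have -> : (\sum_(w in W) #|fib w| ^ 2 = #|C|)%N.
    rewrite -[#|C|]sum1_card.
    rewrite (partition_big (fun c => g c.1.1 c.1.2) (mem W)) /=.
      apply: eq_bigr => w wW; rewrite -mulnn -cardsX -sum1_card.
      apply: eq_bigl => -[[s i] [s' i']]; rewrite !inE /=.
      case: (s \in S); rewrite //= ?andbF //.
      case: (i \in U); rewrite //= ?andbF //.
      have [<-|] := eqVneq (g s i) w; rewrite //= ?andbF ?andbT ?andbA //.
      by rewrite eq_sym.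
    by move=> [[s i] q]; rewrite !inE /= => /andP[/andP[/andP[? ?] _] _]; exact: gW.
  rewrite -cardsX.
  rewrite -(@card_in_imset _ _ (fun c => ((c.1.1, c.2.1), c.1.2)) C).
    apply: subset_leq_card; apply/subsetP => _ /imsetP[[[s i] [s' i']] + ->].
    rewrite !inE /= => /andP[/andP[/andP[-> iU] /andP[-> i'U]] e].
    rewrite iU /= andbT; apply/existsP; exists i; rewrite iU /=.
    by apply/existsP; exists i'; rewrite i'U.
  move=> [[s i] [s' i']] [[t j] [t' j']]; rewrite !inE /=.
  move=> /andP[_ /eqP e] /andP[_ /eqP e'] [] st st' ij; subst.
  by congr (_, (_, _)); apply: (g_inj t'); rewrite -e -e'.
have U0 : (0 < #|U|)%N by apply/card_gt0P; exists i0.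
have := sum_sqr_le W (fun w => #|fib w|); rewrite h1 => h3.
rewrite -(leq_pmul2r U0); apply: leq_trans (_ : (#|S| * #|U|) ^ 2 <= _)%N.
  by rewrite expnMn -mulnA mulnn.
by rewrite (leq_trans h3) // -mulnA leq_mul2l h2 orbT.
Qed.

Lemma double_count (I J : finType) (P : {set I}) (Y : {set J})
    (r : I -> J -> bool) :
  (\sum_(i in P) #|[set j in Y | r i j]| =
   \sum_(j in Y) #|[set i in P | r i j]|)%N.
Proof.
transitivity (\sum_(i in P) \sum_(j in Y) r i j)%N.
  apply: eq_bigr => i _; rewrite -sum1_card -big_mkcondr /=.
  by apply: eq_bigl => j; rewrite inE.
rewrite exchange_big /=; apply: eq_bigr => j _.
by rewrite -sum1_card -big_mkcondr /=; apply: eq_bigl => i; rewrite inE.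
Qed.

(** * Sumsets *)

Definition sumset (L : finFieldType) (A B : {set L}) : {set L} :=
  [set a + b | a in A, b in B].

Definition diffset (L : finFieldType) (A : {set L}) : {set L} :=
  sumset A (dilate (-1) A).

(** The base set [W] is kept arbitrary so that a bound exchanging one summand for copies of another
    can be iterated. *)
Definition add_copies (L : finFieldType) (j : nat) (B W : {set L}) : {set L} :=
  iter j (sumset B) W.

Lemma sumsetP (L : finFieldType) (A B : {set L}) (c : L) :
  reflect (exists a b, [/\ a \in A, b \in B & c = a + b]) (c \in sumset A B).
Proof.
apply: (iffP imset2P) => [[a b aA bB ->]|[a [b [aA bB ->]]]]; first by exists a, b.
by exists a b.
Qed.

Lemma dilateP (L : finFieldType) (c : L) (A : {set L}) (x : L) :
  reflect (exists2 a, a \in A & x = c * a) (x \in dilate c A).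
Proof. exact: imsetP. Qed.

Lemma sumset_in (L : finFieldType) (A B : {set L}) (a b : L) :
  a \in A -> b \in B -> a + b \in sumset A B.
Proof. by move=> aA bB; apply: imset2_f. Qed.

Lemma dilate_in (L : finFieldType) (c : L) (A : {set L}) (a : L) :
  a \in A -> c * a \in dilate c A.
Proof. exact: imset_f. Qed.

Lemma sumsetS (L : finFieldType) (A A' B B' : {set L}) :
  A \subset A' -> B \subset B' -> sumset A B \subset sumset A' B'.
Proof. exact: imset2S. Qed.

Lemma dilateS (L : finFieldType) (c : L) (A B : {set L}) :
  A \subset B -> dilate c A \subset dilate c B.
Proof. exact: imsetS. Qed.

Lemma sumsetC (L : finFieldType) (A B : {set L}) : sumset A B = sumset B A.
Proof.
by apply/setP => c; apply/sumsetP/sumsetP => -[a [b [? ? ->]]]; exists b, a;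
  rewrite addrC.
Qed.

Lemma sum0set (L : finFieldType) (B : {set L}) : sumset set0 B = set0.
Proof.
by apply/setP => x; rewrite inE; apply/sumsetP => -[a [b [+ _ _]]]; rewrite inE.
Qed.

Lemma sumset0r (L : finFieldType) (W : {set L}) : sumset W [set 0] = W.
Proof.
apply/setP => x; apply/sumsetP/idP => [[a [b [aW /set1P-> ->]]]|xW].
  by rewrite addr0.
by exists x, 0; rewrite set11 addr0.
Qed.

Lemma sumsetA (L : finFieldType) (A B C : {set L}) :
  sumset A (sumset B C) = sumset (sumset A B) C.
Proof.
apply/setP => x; apply/sumsetP/sumsetP.
  move=> [a [_ [aA /sumsetP[b [c [bB cC ->]]] ->]]].
  by exists (a + b), c; rewrite sumset_in ?addrA.
move=> [_ [c [/sumsetP[a [b [aA bB ->]]] cC ->]]].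
by exists a, (b + c); rewrite sumset_in ?addrA.
Qed.

Lemma sumsetCA (L : finFieldType) (A B C : {set L}) :
  sumset A (sumset B C) = sumset B (sumset A C).
Proof. by rewrite !sumsetA (sumsetC A). Qed.

Lemma dilateM (L : finFieldType) (c d : L) (A : {set L}) :
  dilate c (dilate d A) = dilate (c * d) A.
Proof.
apply/setP => x; apply/dilateP/dilateP => [[_ /dilateP[a aA ->] ->]|[a aA ->]].
  by exists a; rewrite ?mulrA.
by exists (d * a); rewrite ?dilate_in ?mulrA.
Qed.

Lemma dilate1 (L : finFieldType) (A : {set L}) : dilate 1 A = A.
Proof.
apply/setP => x; apply/dilateP/idP => [[a aA ->]|xA]; first by rewrite mul1r.
by exists x; rewrite ?mul1r.
Qed.

Lemma dilate_sumset (L : finFieldType) (c : L) (A B : {set L}) :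
  dilate c (sumset A B) = sumset (dilate c A) (dilate c B).
Proof.
apply/setP => x; apply/dilateP/sumsetP.
  move=> [_ /sumsetP[a [b [aA bB ->]]] ->].
  by exists (c * a), (c * b); rewrite !dilate_in ?mulrDr.
move=> [_ [_ [/dilateP[a aA ->] /dilateP[b bB ->] ->]]].
by exists (a + b); rewrite ?sumset_in ?mulrDr.
Qed.

Lemma dilateD_sub (L : finFieldType) (c d : L) (A : {set L}) :
  dilate (c + d) A \subset sumset (dilate c A) (dilate d A).
Proof.
apply/subsetP => _ /dilateP[a aA ->].
by rewrite mulrDl sumset_in ?dilate_in.
Qed.

Lemma card_dilate (L : finFieldType) (c : L) (A : {set L}) :
  c != 0 -> #|dilate c A| = #|A|.
Proof. by move=> c0; apply: card_imset; exact: mulfI. Qed.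

Lemma card_sumset_ge (L : finFieldType) (A B : {set L}) :
  B != set0 -> (#|A| <= #|sumset A B|)%N.
Proof.
case/set0Pn=> b bB; rewrite -(card_imset (mem A) (addIr b)) subset_leq_card //.
by apply/subsetP => _ /imsetP[a aA ->]; rewrite sumset_in.
Qed.

Lemma diffset_in (L : finFieldType) (A : {set L}) (a b : L) :
  a \in A -> b \in A -> a - b \in diffset A.
Proof. by move=> aA bA; rewrite -(mulN1r b) sumset_in ?dilate_in. Qed.

Lemma diffsetP (L : finFieldType) (A : {set L}) (x : L) :
  reflect (exists a b, [/\ a \in A, b \in A & x = a - b]) (x \in diffset A).
Proof.
apply: (iffP (sumsetP _ _ _)).
  by move=> [a [_ [aA /dilateP[b bA ->] ->]]]; exists a, b; rewrite mulN1r.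
by move=> [a [b [aA bA ->]]]; exists a, (-1 * b); rewrite dilate_in ?mulN1r.
Qed.

Lemma dilate_diffset (L : finFieldType) (c : L) (A : {set L}) :
  dilate c (diffset A) = diffset (dilate c A).
Proof. by rewrite dilate_sumset /diffset !dilateM mulrC. Qed.

Lemma diffsetN (L : finFieldType) (A : {set L}) :
  dilate (-1) (diffset A) = diffset A.
Proof.
by rewrite /diffset dilate_sumset dilateM mulrNN mulr1 dilate1 sumsetC.
Qed.

Lemma diffset0 (L : finFieldType) (A : {set L}) : A != set0 -> 0 \in diffset A.
Proof. by case/set0Pn=> a aA; rewrite -(subrr a) diffset_in. Qed.

Lemma add_copiesS (L : finFieldType) (j : nat) (B W : {set L}) :
  add_copies j.+1 B W = sumset B (add_copies j B W).
Proof. by []. Qed.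

Lemma add_copies_sumset (L : finFieldType) (j : nat) (B W V : {set L}) :
  add_copies j B (sumset V W) = sumset V (add_copies j B W).
Proof. by elim: j => //= j ->; rewrite sumsetCA. Qed.

Lemma add_copiesD (L : finFieldType) (i j : nat) (B W : {set L}) :
  add_copies (i + j) B W = add_copies i B (add_copies j B W).
Proof. exact: iterD. Qed.

Lemma add_copiesC (L : finFieldType) (i j : nat) (B C W : {set L}) :
  add_copies i B (add_copies j C W) = add_copies j C (add_copies i B W).
Proof. by elim: i => //= i ->; rewrite -add_copies_sumset. Qed.

Lemma dilate_add_copies (L : finFieldType) (c : L) (j : nat) (B W : {set L}) :
  dilate c (add_copies j B W) = add_copies j (dilate c B) (dilate c W).
Proof. by elim: j => //= j; rewrite dilate_sumset => ->. Qed.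

(** * The inequalities of Ruzsa and Pluennecke *)

(** Fix one representation d = w + z of each d in the sumset. Then (u, d) is sent injectively to (w
    + u, z - u): the coordinates add up to d, which determines w and hence u. *)
Lemma ruzsa_triangle (L : finFieldType) (U W Z : {set L}) :
  (#|U| * #|sumset W Z| <=
   #|sumset W U| * #|sumset Z (dilate (-1)%R U)|)%N.
Proof.
(* The default pair is never met, as [rep] is only evaluated on the sumset. *)
pose rep (d : L) := odflt (0, 0) [pick p in setX W Z | p.1 + p.2 == d].
have repP d : d \in sumset W Z ->
    [/\ (rep d).1 \in W, (rep d).2 \in Z & (rep d).1 + (rep d).2 = d].
  move=> /sumsetP[a [b [aW bZ ->]]]; rewrite /rep; case: pickP => [p|].
    by rewrite inE => /andP[/andP[? ?] /eqP].
  by move=> /(_ (a, b)); rewrite !inE /= aW bZ eqxx.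
rewrite -!cardsX.
pose f (q : L * L) := ((rep q.2).1 + q.1, (rep q.2).2 - q.1).
rewrite -(@card_in_imset _ _ f (setX U (sumset W Z))).
  apply: subset_leq_card; apply/subsetP => _ /imsetP[[u d] + ->].
  rewrite !inE /= => /andP[uU /repP[? ? _]].
  by rewrite sumset_in //= -[- u]mulN1r sumset_in ?dilate_in.
move=> [u d] [u' d']; rewrite !inE /=.
move=> /andP[_ /repP[_ _ e]] /andP[_ /repP[_ _ e']] [h1 h2].
have dd : d = d'.
  rewrite -e -e'; transitivity ((rep d).1 + u + ((rep d).2 - u)); first by ring.
  by rewrite h1 h2; ring.
by move: h1; rewrite dd => /addrI ->.
Qed.

(* Petridis' form of Pluennecke's inequality. *)
Lemma petridis (L : finFieldType) (Z B : {set L}) :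
  (forall Z' : {set L}, Z' \subset Z ->
     #|sumset Z B| * #|Z'| <= #|sumset Z' B| * #|Z|)%N ->
  forall C : {set L},
    (#|sumset C (sumset Z B)| * #|Z| <= #|sumset Z B| * #|sumset C Z|)%N.
Proof.
move=> Zmin C; have [n] := ubnP #|C|.
elim: n C => // n IHn D; rewrite ltnS; have [->|[c cD] leD] := set_0Vmem D.
  by rewrite sum0set cards0.
have := IHn (D :\ c); rewrite (cardsD1 c) cD in leD; move=> /(_ leD) {IHn leD}.
rewrite -{3 4}(setD1K cD); move: (D :\ c) => C' IH {cD}.
set ZB := sumset Z B in Zmin IH *; set C := _ |: C'.
pose tr (W : {set L}) : {set L} := [set c + w | w in W].
have card_tr W : #|tr W| = #|W| by rewrite card_imset //; exact: addrI.
have split W : sumset C W = sumset C' W :|: tr W.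
  apply/setP => x; rewrite inE; apply/sumsetP/orP.
    move=> [a [b [+ bW ->]]]; rewrite !inE => /orP[/eqP->|aC'].
      by right; apply: imset_f.
    by left; apply: sumset_in.
  move=> [/sumsetP[a [b [aC' bW ->]]]|/imsetP[b bW ->]].
    by exists a, b; rewrite !inE aC' orbT.
  by exists c, b; rewrite !inE eqxx.
(* [Z0] collects the z for which c + z + [B] brings nothing new. The new element c therefore adds at
   most |Z + B| - |Z0 + B| to the left side, while any z with c + z already in C' + Z lies in [Z0],
   so the right side grows by at least |Z| - |Z0|. Minimality of [Z], applied to [Z0], compares the
   two. *)
pose Z0 := [set z in Z | [forall b in B, c + (z + b) \in sumset C' ZB]].
have Z0Z : Z0 \subset Z by apply/subsetP => z; rewrite inE => /andP[].
have h1 : (#|sumset C ZB| + #|sumset Z0 B| <= #|sumset C' ZB| + #|ZB|)%N.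
  have -> : sumset C ZB = sumset C' ZB :|: (tr ZB :\: tr (sumset Z0 B)).
    rewrite split; apply/setP => x; rewrite !inE.
    case: (boolP (x \in tr (sumset Z0 B))) => //= /imsetP[_ /sumsetP[z [b [+ bB ->]]] ->].
    rewrite inE => /andP[zZ /forallP/(_ b)]; rewrite bB /= => -> //.
  have := cardsD (tr ZB) (tr (sumset Z0 B)).
  have /setIidPr -> : tr (sumset Z0 B) \subset tr ZB.
    by rewrite imsetS // sumsetS.
  rewrite !card_tr => h.
  have := cardsU (sumset C' ZB) (tr ZB :\: tr (sumset Z0 B)).
  have : (#|sumset Z0 B| <= #|ZB|)%N by rewrite subset_leq_card // sumsetS.
  lia.
have h2 : (#|sumset C' Z| + #|Z| <= #|sumset C Z| + #|Z0|)%N.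
  rewrite split -(card_tr Z) -cardsUI leq_add2l.
  rewrite -(card_tr Z0) subset_leq_card //; apply/subsetP => x /setIP[+ /imsetP[z zZ e]].
  rewrite e => h; apply: imset_f; rewrite inE zZ /=.
  apply/forallP => b; apply/implyP => bB.
  by rewrite addrA /ZB sumsetA sumset_in.
have := Zmin _ Z0Z.
have := subset_leq_card Z0Z.
nia.
Qed.

(** Take a nonempty [Z] in [R] minimising |Z - R| / |Z|. Petridis' inequality bounds [Z] plus j
    copies of -R by kappa^j |Z|, and the triangle inequality through [Z] squares this to bound j
    copies of R - R. *)
Lemma card_add_copies_diffset (L : finFieldType) (R : {set L}) (kappa j : nat) :
  R != set0 -> (#|diffset R| <= kappa * #|R|)%N ->
  (#|add_copies j (diffset R) [set 0%R]| <= kappa ^ (2 * j) * #|R|)%N.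
Proof.
move=> R0 small; set N := dilate (-1) R.
have [Z /andP[ZR Z0] Zmin] : exists2 Z : {set L}, (Z \subset R) && (Z != set0) &
   forall Z' : {set L}, Z' \subset R -> Z' != set0 ->
     (#|sumset Z N| * #|Z'| <= #|sumset Z' N| * #|Z|)%N.
  pose P (Z : {set L}) := (Z \subset R) && (Z != set0).
  pose ratio (Z : {set L}) : rat := #|sumset Z N|%:R / #|Z|%:R.
  have PR : P R by rewrite /P subxx R0.
  case: (@arg_minP _ _ _ R P ratio PR) => Z PZ Zmin; exists Z => // Z' Z'R Z'0.
  have pos (W : {set L}) : W != set0 -> (0 < #|W|%:R :> rat).
    by rewrite ltr0n card_gt0.
  have /andP[_ Z0] := PZ.
  have := Zmin Z'; rewrite /P Z'R Z'0 => /(_ isT); rewrite /ratio.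
  by rewrite ler_pdivrMr ?pos // mulrAC ler_pdivlMr ?pos // -!natrM ler_nat.
have Zc : (0 < #|Z|)%N by rewrite card_gt0.
have ZN : (#|sumset Z N| <= kappa * #|Z|)%N.
  have := Zmin R (subxx _) R0; have Rc : (0 < #|R|)%N by rewrite card_gt0.
  move=> h; rewrite -(leq_pmul2r Rc) (leq_trans h) //.
  by rewrite mulnAC leq_mul2r small orbT.
have grow i : (#|sumset Z (add_copies i N [set 0%R])| <= kappa ^ i * #|Z|)%N.
  elim: i => [|i IH] /=.
    rewrite mul1n -(card_imset (mem Z) (addIr 0)) subset_leq_card //.
    apply/subsetP => _ /sumsetP[z [w [zZ + ->]]]; rewrite inE => /eqP->.
    exact: imset_f.
  rewrite expnS -(leq_pmul2r Zc).
  rewrite sumsetA sumsetC.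
  apply: leq_trans (_ : #|sumset Z N| * #|sumset (add_copies i N [set 0%R]) Z| <= _)%N.
    apply: petridis => Z' Z'Z.
    have [->|Z'0] := eqVneq Z' set0; first by rewrite cards0 muln0.
    exact/Zmin/Z'0/(subset_trans Z'Z).
  by rewrite (sumsetC _ Z) (leq_trans (leq_mul ZN IH)) // mulnACA !mulnA leqnn.
pose B i := add_copies i N [set 0%R].
have -> : add_copies j (diffset R) [set 0] = sumset (B j) (dilate (-1) (B j)).
  rewrite /B; elim: j => [|j IH].
    apply/setP => x; rewrite inE; apply/eqP/sumsetP => [->|].
      exists 0, (-1 * 0); split; [exact: set11 | exact/dilate_in/set11 |].
      by rewrite mulr0 addr0.
    move=> [_ [_ [/set1P-> /dilateP[_ /set1P-> ->] ->]]].
    by rewrite mulr0 addr0.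
  rewrite !add_copiesS IH dilate_sumset /diffset.
  rewrite dilateM mulrNN mulr1 dilate1 -/N.
  by rewrite -!sumsetA sumsetCA; congr sumset; rewrite (sumsetCA R).
have h := ruzsa_triangle Z (B j) (dilate (-1) (B j)).
rewrite -dilate_sumset card_dilate ?oppr_eq0 ?oner_eq0 // in h.
rewrite (sumsetC (B j) Z) in h.
rewrite mul2n -addnn expnD -(leq_pmul2l Zc); apply: leq_trans h _.
have g := grow j; have ZRc := subset_leq_card ZR.
apply: leq_trans (leq_mul g g) _.
rewrite mulnACA [X in (_ <= X)%N]mulnCA leq_mul2l; apply/orP; right.
by rewrite leq_mul2l ZRc orbT.
Qed.

(** * Stabilisers, generated subfields and generated subspaces *)

(** Inverses are the only point: a nonzero d maps the finite set [V] injectively into itself, hence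
    onto itself, so its inverse stabilises [V] too. Consequently closure of the pivots under a set
    of scalars extends to the subfield it generates. *)
Lemma stabilizer_subfield (L : finFieldType) (V : {set L}) :
  GRing.zmod_closed V -> is_subfield [set c | dilate c V \subset V].
Proof.
move=> [V0 VB].
have stab c : reflect (forall v, v \in V -> c * v \in V)
    (c \in [set c | dilate c V \subset V]).
  rewrite inE; apply: (iffP subsetP) => [h v vV|h _ /dilateP[v vV ->]].
    exact/h/dilate_in.
  exact: h.
split; first by apply/stab => v; rewrite mul1r.
  move=> c d /stab hc /stab hd; apply/stab => v vV.
  by rewrite mulrBl VB ?hc ?hd.
move=> c d /stab hc dS; apply/stab => v vV; rewrite -mulrA hc //.
have [->|d0] := eqVneq d 0; first by rewrite invr0 mul0r.
have e : dilate d V = V.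
  by apply/eqP; rewrite eqEcard card_dilate // leqnn andbT; move: dS; rewrite inE.
have : d^-1 * v \in dilate d^-1 (dilate d V) by rewrite e dilate_in.
by rewrite dilateM mulVf // dilate1.
Qed.

Lemma subfield_generated_exists (L : finFieldType) (X : {set L}) :
  exists F, subfield_generated X F.
Proof.
exists [set x | `[< forall G : {set L}, is_subfield G -> X \subset G -> x \in G >]].
have memP x : reflect (forall G : {set L}, is_subfield G -> X \subset G -> x \in G)
    (x \in [set x | `[< forall G : {set L},
       is_subfield G -> X \subset G -> x \in G >]]).
  by rewrite inE; apply: asboolP.
split.
- split; first by apply/memP => G [].
    move=> x y /memP hx /memP hy; apply/memP => G GF XG; have [_ GB _] := GF.
    by rewrite GB ?hx ?hy.
  move=> x y /memP hx /memP hy; apply/memP => G GF XG; have [_ _ GV] := GF.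
  by rewrite GV ?hx ?hy.
- by apply/subsetP => x xX; apply/memP => G _ /subsetP; exact.
- by move=> G GF XG; apply/subsetP => x /memP; exact.
Qed.

Lemma subspace_generated_exists (L : finFieldType) (F A : {set L}) :
  exists V, subspace_generated F A V.
Proof.
exists [set x | `[< forall G : {set L}, is_subspace F G -> A \subset G -> x \in G >]].
have memP x : reflect (forall G : {set L}, is_subspace F G -> A \subset G -> x \in G)
    (x \in [set x | `[< forall G : {set L},
       is_subspace F G -> A \subset G -> x \in G >]]).
  by rewrite inE; apply: asboolP.
split.
- split; first split; first by apply/memP => G [[]].
    move=> x y /memP hx /memP hy; apply/memP => G GF XG; have [[_ GB] _] := GF.
    by rewrite GB ?hx ?hy.
  move=> c v cF /memP hv; apply/memP => G GF XG; have [_ GM] := GF.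
  by rewrite GM ?hv.
- by apply/subsetP => x xX; apply/memP => G _ /subsetP; exact.
- by move=> G GF XG; apply/subsetP => x /memP; exact.
Qed.

(** The copies of [B] are exchanged one by one; the copies of [C] already produced are absorbed into
    the base set, which is why the hypothesis ranges over all [W]. *)
Lemma card_add_copies_le (L : finFieldType) (B C : {set L}) (i t : nat) :
  (forall W : {set L}, #|sumset B W| <= t * #|add_copies i C W|)%N ->
  forall (j : nat) (W : {set L}),
    (#|add_copies j B W| <= t ^ j * #|add_copies (j * i) C W|)%N.
Proof.
move=> hB; elim=> [|j IH] W; first by rewrite mul1n.
rewrite add_copiesS (leq_trans (hB _)) // add_copiesC expnS -mulnA.
by rewrite leq_mul2l mulSn addnC add_copiesD IH orbT.
Qed.

(** * Pivots *)

Section Pivot.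

Variables (L : finFieldType) (R X : {set L}) (kappa tau : nat).
Hypotheses (R_neq0 : R != set0) (X_neq0 : X != set0).
Hypothesis small_diff : (#|diffset R| <= kappa * #|R|)%N.
Hypothesis small_dilate : forall x, x \in X -> exists U : {set L},
  [/\ U \subset R, U != set0
    & #|sumset (dilate x R) (dilate (-1)%R U)| <= tau * #|U|]%N.

Let D := diffset R.

Let R_gt0 : (0 < #|R|)%N. Proof. by rewrite card_gt0. Qed.
Let X_gt0 : (0 < #|X|)%N. Proof. by rewrite card_gt0. Qed.

Let D_neq0 : D != set0.
Proof. by apply/set0Pn; exists 0; exact: diffset0. Qed.

Let D_ge : (#|R| <= #|D|)%N.
Proof.
rewrite /D /diffset sumsetC; rewrite sumsetC card_sumset_ge //.
by rewrite -card_gt0 card_dilate ?oppr_eq0 ?oner_eq0.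
Qed.

Let kappa_gt0 : (0 < kappa)%N.
Proof. have := leq_trans D_ge small_diff; rewrite -/D; nia. Qed.

Let tau_gt0 : (0 < tau)%N.
Proof.
have /set0Pn[x /small_dilate[U [_ U0]]] := X_neq0.
have : (0 < #|sumset (dilate x R) (dilate (-1)%R U)|)%N.
  have /set0Pn[u uU] := U0; have /set0Pn[r rR] := R_neq0.
  by apply/card_gt0P; exists (x * r + -1 * u); rewrite sumset_in ?dilate_in.
by case: tau => // h; rewrite mul0n leqNgt h.
Qed.

(** The triangle inequality through [U] bounds |U| |W + xR| by |W + U| |xR - U|, and [U] lies in
    [R]. The set [U], which depends on x, disappears from the conclusion. *)
Lemma card_sumset_dilate (x : L) (W : {set L}) : x \in X ->
  (#|sumset W (dilate x R)| <= tau * #|sumset W R|)%N.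
Proof.
move=> /small_dilate[U [UR U0 hU]].
have U0' : (0 < #|U|)%N by rewrite card_gt0.
rewrite -(leq_pmul2l U0'); apply: leq_trans (ruzsa_triangle _ _ _) _.
rewrite mulnCA mulnA mulnC; apply: leq_trans (leq_mul hU (leqnn _)) _.
by rewrite leq_mul2l subset_leq_card ?orbT // sumsetS.
Qed.

Lemma card_sumset_dilateD (x : L) (W : {set L}) : x \in X ->
  (#|sumset (dilate x D) W| <= tau ^ 2 * #|add_copies 1 D W|)%N.
Proof.
move=> xX; have n1 : (-1 : L) != 0 by rewrite oppr_eq0 oner_eq0.
have neg V : (#|sumset V (dilate x (dilate (-1)%R R))| <=
              tau * #|sumset V (dilate (-1)%R R)|)%N.
  rewrite -(card_dilate _ n1) -[X in (_ <= _ * X)%N](card_dilate _ n1).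
  rewrite !dilate_sumset !dilateM (_ : -1 * x * -1 = x) ?mulrNN ?mulr1 ?dilate1 //; last by ring.
  exact: card_sumset_dilate.
have -> : sumset (dilate x D) W =
    sumset (sumset W (dilate x (dilate (-1) R))) (dilate x R).
  by rewrite /D /diffset dilate_sumset sumsetC (sumsetC (dilate x R)) sumsetA.
have -> : add_copies 1 D W = sumset (sumset W R) (dilate (-1) R).
  by rewrite -sumsetA sumsetC.
rewrite (leq_trans (card_sumset_dilate _ xX)) // -mulnn -mulnA leq_mul2l.
apply/orP; right.
by rewrite -sumsetA (sumsetC (dilate x _)) sumsetA neg.
Qed.

Definition mixed (s : L) : Prop := exists x1 x2 x3 x4 : L,
  [/\ x1 \in X, x2 \in X, x3 \in X, x4 \in X & s = (x1 - x2) - (x3 - x4)].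

(** As D = -D, the set sD lies in x1 D + x2 D + x3 D + x4 D, and each of the four dilates is
    exchanged for [D] at cost tau^2. Such s arise as differences of two scalars p.1 - p.2 coming
    from hits. *)
Lemma card_sumset_mixed (s : L) (W : {set L}) : mixed s ->
  (#|sumset (dilate s D) W| <= tau ^ 8 * #|add_copies 4 D W|)%N.
Proof.
move=> [x1 [x2 [x3 [x4 [h1 h2 h3 h4 ->]]]]].
have dN x : dilate (- x) D = dilate x D.
  by rewrite -[in RHS](diffsetN R : _ = D) dilateM mulrN1.
have sub : dilate (x1 - x2 - (x3 - x4)) D \subset
    sumset (dilate x1 D) (sumset (dilate x2 D)
      (sumset (dilate x3 D) (dilate x4 D))).
  rewrite -(dN x2) -(dN x3) opprB sumsetA addrC addrC addrA.
  rewrite (subset_trans (dilateD_sub _ _ _)) //.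
  rewrite (sumsetC (dilate (- x3) D)) sumsetA.
  rewrite sumsetS // ?(subset_trans (dilateD_sub _ _ _)) //.
  by rewrite sumsetS // dilateD_sub.
apply: leq_trans (subset_leq_card (sumsetS sub (subxx W))) _.
rewrite -!sumsetA (leq_trans (card_sumset_dilateD _ h1)) //.
rewrite add_copies_sumset.
rewrite (expnD tau 2 6) -mulnA leq_mul2l; apply/orP; right.
rewrite (leq_trans (card_sumset_dilateD _ h2)) // -add_copiesD.
rewrite add_copies_sumset (expnD tau 2 4) -mulnA leq_mul2l; apply/orP; right.
rewrite (leq_trans (card_sumset_dilateD _ h3)) // -add_copiesD.
rewrite add_copies_sumset (expnD tau 2 2) -mulnA leq_mul2l; apply/orP; right.
by rewrite (leq_trans (card_sumset_dilateD _ h4)) // -add_copiesD.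
Qed.

Definition hits (v : L) : {set L * L} :=
  [set p in setX X X | (p.1 - p.2) * v \in D].

(** The map (y, r) -> ycv - cr sends [Y] times [R] into W - cR, which is no larger than W + cD. A
    collision says c(y - y')v = c(r - r'), and cancelling c gives a hit. *)
Lemma hits_ge (Y W : {set L}) (c v : L) (lam : nat) :
  Y \subset X -> c != 0 -> (forall y, y \in Y -> y * c * v \in W) ->
  (#|sumset W (dilate c D)| <= lam * #|R| -> #|Y| ^ 2 <= lam * #|hits v|)%N.
Proof.
move=> YX c0 hW hlam; set W' := sumset W (dilate c (dilate (-1) R)).
have W'small : (#|W'| <= lam * #|R|)%N.
  apply: leq_trans hlam; rewrite /D /diffset dilate_sumset sumsetCA sumsetC.
  by rewrite card_sumset_ge // -card_gt0 card_dilate.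
pose g y r := y * c * v - c * r.
have gW y r : y \in Y -> r \in R -> g y r \in W'.
  move=> yY rR; rewrite /g -mulrN -(mulN1r r).
  by rewrite sumset_in ?hW // dilate_in ?dilate_in.
have g_inj y : injective (g y) by move=> r r' /addrI/oppr_inj/(mulfI c0).
have h := near_pairs gW g_inj.
rewrite -(leq_pmul2r R_gt0); apply: leq_trans h _.
rewrite -mulnA (mulnC #|hits v|) mulnA leq_mul //.
apply/subset_leq_card/subsetP => -[y y']; rewrite !inE /=.
move=> /andP[/andP[yY y'Y] /existsP[r /andP[rR /existsP[r' /andP[r'R /eqP e]]]]].
rewrite !(subsetP YX) //=.
have -> : (y - y') * v = r - r'; last exact: diffset_in.
apply: (mulfI c0); transitivity (g y r - g y' r' + c * (r - r')).
  by rewrite /g; ring.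
by rewrite e subrr add0r.
Qed.

(* Membership improves itself: having [2 tau^2 #|X|] such pairs already forces
   a positive proportion of all pairs of [X], up to powers of [tau] and
   [kappa]. *)
Definition pivots : {set L} := [set v | 2 * tau ^ 2 * #|X| <= #|hits v|]%N.

(** Write (p.1 - p.2)v = a - b with a, b in [R] for each hit p. The pairs (ya - u, yb - u') with u,
    u' in [U] lie in the square of the small set yR - U. A collision between p and q puts both
    coordinate differences in U - U, and subtracting them gives an element of D + D. *)
Lemma near_hits (v y : L) : y \in X ->
  (#|hits v| ^ 2 <= tau ^ 2 * #|[set pq in setX (hits v) (hits v) |
     (y * ((pq.1.1 - pq.1.2) - (pq.2.1 - pq.2.2)) * v)%R \in sumset D D]|)%N.
Proof.
move=> yX; set M := hits v; set G := [set pq in _ | _].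
pose rep d := odflt (0, 0) [pick q in setX R R | q.1 - q.2 == d].
have repP p : p \in M -> [/\ (rep ((p.1 - p.2) * v)).1 \in R,
    (rep ((p.1 - p.2) * v)).2 \in R &
    (rep ((p.1 - p.2) * v)).1 - (rep ((p.1 - p.2) * v)).2 = (p.1 - p.2) * v].
  rewrite inE => /andP[_ /diffsetP[a [b [aR bR ->]]]].
  rewrite /rep; case: pickP => [q|].
    by rewrite inE => /andP[/andP[? ?] /eqP].
  by move=> /(_ (a, b)); rewrite !inE /= aR bR eqxx.
have [U [UR U0 hU]] := small_dilate yX.
have UU0 : (0 < #|setX U U|)%N by rewrite cardsX muln_gt0 card_gt0 U0.
set W := sumset _ _ in hU.
pose g (p u : L * L) := (y * (rep ((p.1 - p.2) * v)).1 - u.1,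
                         y * (rep ((p.1 - p.2) * v)).2 - u.2).
have gW p u : p \in M -> u \in setX U U -> g p u \in setX W W.
  case: u => u u' /repP[h1 h2 _]; rewrite !inE /= => /andP[uU u'U].
  by rewrite -[- u]mulN1r -[- u']mulN1r !sumset_in ?dilate_in.
have g_inj p : injective (g p).
  by move=> [u u'] [w w'] [/addrI/oppr_inj -> /addrI/oppr_inj ->].
have h := near_pairs gW g_inj.
rewrite -(leq_pmul2r UU0); apply: leq_trans h _.
rewrite !cardsX [X in (_ <= X)%N]mulnAC leq_mul //.
  by rewrite -mulnn mulnACA leq_mul.
apply/subset_leq_card/subsetP => -[p q].
move=> /setIdP[/setXP[pM qM] /existsP[[u u'] /andP[/setXP[uU u'U]]]].
move=> /existsP[[w w'] /andP[/setXP[wU w'U] /eqP[e e']]].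
apply/setIdP; split; first exact/setXP.
rewrite /= in u'U wU w'U uU e e' *.
have [_ _ hp] := repP _ pM; have [_ _ hq] := repP _ qM.
have -> : y * (p.1 - p.2 - (q.1 - q.2)) * v = (u - w) + (w' - u').
  have -> : y * (p.1 - p.2 - (q.1 - q.2)) * v =
    y * ((p.1 - p.2) * v) - y * ((q.1 - q.2) * v) by ring.
  rewrite -hp -hq.
  have -> : u = y * (rep ((p.1 - p.2) * v)).1 -
    (y * (rep ((q.1 - q.2) * v)).1 - w) by rewrite -e; ring.
  have -> : u' = y * (rep ((p.1 - p.2) * v)).2 -
    (y * (rep ((q.1 - q.2) * v)).2 - w') by rewrite -e'; ring.
  ring.
by rewrite sumset_in // diffset_in // (subsetP UR).
Qed.

(* Pigeonhole: for fixed [y] the products [y * (p.1 - p.2) * v] with [p] in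
   [hits v] fall into few translates of [D], so one difference [s] of two
   scalars [p.1 - p.2] works for a positive proportion of the [y]. *)
Lemma amplify (v : L) (Y : {set L}) :
  v \in pivots -> Y \subset X -> Y != set0 ->
  exists (s : L) (Y' : {set L}),
    [/\ s != 0, mixed s, Y' \subset Y, (#|Y| <= 2 * tau ^ 2 * #|Y'|)%N
      & forall y, y \in Y' -> y * s * v \in sumset D D].
Proof.
rewrite inE => vP YX Y0; set M := hits v in vP.
have M_gt0 : (0 < #|M|)%N.
  by apply: leq_trans vP; rewrite !muln_gt0 X_gt0 tau_gt0.
pose dif (pq : (L * L) * (L * L)) := (pq.1.1 - pq.1.2) - (pq.2.1 - pq.2.2).
pose r pq y := (dif pq != 0) && (y * dif pq * v \in sumset D D).
(* A zero scalar would be useless, as it has to be cancelled later. In a degenerate pair, p and the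
   second coordinate of q determine q. *)
have dif0 : (#|[set pq in setX M M | dif pq == 0%R]| <= #|M| * #|X|)%N.
  rewrite -cardsX -(@card_in_imset _ _ (fun pq => (pq.1, pq.2.2))).
    apply/subset_leq_card/subsetP => _ /imsetP[[p [a b]] + ->].
    by move=> /setIdP[/setXP[pM /setIdP[/setXP[_ bX] _]] _]; apply/setXP.
  move=> [p [a b]] [p' [a' b']] /setIdP[_ /eqP e] /setIdP[_ /eqP e'] [pp bb].
  move: e e'; rewrite /dif /= pp bb => e e'; congr (_, (_, _)).
  move: e => /eqP; rewrite subr_eq0 => /eqP e.
  by move: e' => /eqP; rewrite subr_eq0 e => /eqP/addIr.
have many y : y \in Y ->
    (#|setX M M| <= 2 * tau ^ 2 * #|[set pq in setX M M | r pq y]|)%N.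
  move=> yY; have := near_hits v (subsetP YX _ yY); rewrite -/M.
  set G := [set pq in _ | _]; rewrite cardsX mulnn => hG.
  have : (#|G| <= #|[set pq in setX M M | r pq y]| +
                  #|[set pq in setX M M | dif pq == 0%R]|)%N.
    apply: leq_trans (_ : #|[set pq in setX M M | r pq y] :|:
                            [set pq in setX M M | dif pq == 0%R]| <= _)%N.
      apply/subset_leq_card/subsetP => pq /setIdP[pqM h].
      case: (eqVneq (dif pq) 0) => d0; apply/setUP; [right|left].
        by apply/setIdP; split; rewrite ?d0.
      by apply/setIdP; split; rewrite // /r d0.
    by rewrite cardsU leq_subr.
  move: vP dif0 hG.
  set g := #|G|; set a := #|[set pq in _ | r pq y]|.
  set b := #|[set pq in _ | _]|; set m := #|M|; set x := #|X|.
  move=> h1 h2 h3 h4.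
  (* The origin of the pivot threshold: it makes the degenerate pairs at most half of those supplied
     by [near_hits]. *)
  have h5 : (2 * tau ^ 2 * b <= m ^ 2)%N.
    rewrite -mulnn; apply: leq_trans (leq_mul (leqnn _) h2) _.
    by rewrite mulnCA leq_mul2l h1 orbT.
  have h6 : (2 * m ^ 2 <= 2 * tau ^ 2 * a + 2 * tau ^ 2 * b)%N.
    by rewrite -mulnDr -mulnA leq_mul2l /= (leq_trans h3) // leq_mul2l h4 orbT.
  lia.
have S0 : (0 < #|setX M M|)%N by rewrite cardsX muln_gt0 M_gt0.
have [] := @avg_le _ (setX M M) (fun pq => #|[set y in Y | r pq y]|)
             #|Y| (2 * tau ^ 2) S0.
  rewrite double_count big_distrr /= mulnC -sum_nat_const.
  by apply: leq_sum => y; exact: many.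
move=> [[x1 x2] [x3 x4]].
move=> /setXP[/setIdP[/setXP[h1 h2] _] /setIdP[/setXP[h3 h4] _]] hY.
set Y' := [set y in Y | _] in hY; exists (dif ((x1, x2), (x3, x4))), Y'.
have /set0Pn[y] : Y' != set0.
  rewrite -card_gt0; case: (posnP #|Y'|) => // e.
  by move: hY; rewrite e muln0 leqn0 cards_eq0 (negPf Y0).
rewrite inE => /andP[_ /andP[d0 _]]; split=> //.
- by exists x1, x2, x3, x4.
- by apply/subsetP => z /setIdP[].
by move=> z /setIdP[_ /andP[]].
Qed.

(** The factor tau^72 kappa^64 is the cost of [pivotsD]: exchanging 1 + 6 + 2 mixed dilates at tau^8
    each leaves 24 + 8 = 32 copies of [D], worth kappa^64. The remaining 32 tau^10 is (4 tau^4)^2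
    for two amplifications times the threshold factor 2 tau^2. *)
Hypothesis X_large : (32 * tau ^ 82 * kappa ^ 64 <= #|X|)%N.

(** The way back from the quadratic count to the linear threshold: [hits_ge] gives at least a fixed
    proportion of [#|X| ^ 2] hits, which [X_large] makes exceed 2 tau^2 [#|X|]. The set [Y] may have
    lost 2 tau^2 in each of two amplifications. *)
Lemma pivots_intro (Y W : {set L}) (c v : L) :
  Y \subset X -> (#|X| <= 4 * tau ^ 4 * #|Y|)%N ->
  c != 0 -> (forall y, y \in Y -> y * c * v \in W) ->
  (#|sumset W (dilate c D)| <= tau ^ 72 * kappa ^ 64 * #|R|)%N ->
  v \in pivots.
Proof.
move=> YX Ylarge c0 hW hlam; have hy := hits_ge YX c0 hW hlam; rewrite inE.
move: X_large Ylarge; set h := #|hits v|; set x := #|X|; set y := #|Y|.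
set lam := (tau ^ 72 * kappa ^ 64)%N in hy *.
have -> : (32 * tau ^ 82 * kappa ^ 64 = 32 * (tau ^ 10 * lam))%N.
  by rewrite (_ : 82 = 10 + 72)%N // expnD /lam !mulnA.
move=> xl yl.
have t4 : (0 < 16 * tau ^ 8)%N by rewrite muln_gt0 expn_gt0 tau_gt0.
have l0 : (0 < lam)%N by rewrite muln_gt0 !expn_gt0 tau_gt0 kappa_gt0.
have hx : (x ^ 2 <= 16 * tau ^ 8 * lam * h)%N.
  rewrite -[X in (_ <= X)%N]mulnA; apply: leq_trans (leq_mul (leqnn _) hy).
  apply: leq_trans (_ : (4 * tau ^ 4 * y) ^ 2 <= _)%N; first by rewrite leq_sqr.
  rewrite (_ : 16 * tau ^ 8 = (4 * tau ^ 4) ^ 2)%N -?expnMn //.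
  by rewrite expnMn -(expnM tau 4 2).
have t4l : (0 < 16 * tau ^ 8 * lam)%N by rewrite muln_gt0 t4.
rewrite -(leq_pmul2l t4l); apply: leq_trans hx.
rewrite -mulnn.
have -> : (16 * tau ^ 8 * lam * (2 * tau ^ 2 * x) =
           32 * (tau ^ 10 * lam) * x)%N.
  by rewrite (expnD tau 8 2) (_ : 32 = 16 * 2)%N //; ring.
by rewrite leq_mul2r xl orbT.
Qed.

Lemma card_copies_small (i j : nat) :
  (i <= 72)%N -> (j <= 32)%N ->
  (tau ^ i * #|add_copies j D [set 0%R]| <= tau ^ 72 * kappa ^ 64 * #|R|)%N.
Proof.
move=> hi hj; have := card_add_copies_diffset j R_neq0 small_diff => h.
rewrite -mulnA; apply: leq_mul; first by rewrite leq_pexp2l.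
apply: leq_trans h _; rewrite leq_mul2r; apply/orP; right.
by rewrite leq_pexp2l //; lia.
Qed.

(** The set [Y] and scalar [s] obtained for v serve x * v as well, with D + D replaced by its dilate
    by x, which costs only powers of [tau]. *)
Lemma pivotsM (x v : L) : x \in X -> v \in pivots -> x * v \in pivots.
Proof.
move=> xX vP; have [s [Y [s0 hs YX hY hW]]] := amplify vP (subxx X) X_neq0.
apply: (@pivots_intro Y (dilate x (sumset D D)) s) => //.
- apply: leq_trans hY _; rewrite leq_mul2r; apply/orP; right.
  by rewrite (expnD tau 2 2) mulnA -[X in (X <= _)%N]muln1 leq_mul ?leq_mul //
     expn_gt0 tau_gt0.
- move=> y yY; have -> : y * s * (x * v) = x * (y * s * v) by ring.
  by rewrite dilate_in ?hW.
rewrite dilate_sumset sumsetC.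
apply: leq_trans (card_sumset_mixed _ hs) _.
have -> : sumset (dilate x D) (dilate x D) = add_copies 2 (dilate x D) [set 0].
  by rewrite !add_copiesS sumset0r.
rewrite add_copiesC.
apply: leq_trans (leq_mul (leqnn _)
  (card_add_copies_le (fun W => card_sumset_dilateD W xX) _ _)) _.
by rewrite -expnM mulnA -expnD -add_copiesD card_copies_small.
Qed.

(* Amplifying [w] inside the set [Y] obtained for [v] makes both products
   [y * s * v] and [y * s' * w] small for the same [y]; multiplying by [s * s']
   clears the denominators. *)
Lemma pivotsD (v w : L) : v \in pivots -> w \in pivots -> v + w \in pivots.
Proof.
move=> vP wP; have [s [Y [s0 hs YX hY hv]]] := amplify vP (subxx X) X_neq0.
have Y0 : Y != set0.
  rewrite -card_gt0; case: (posnP #|Y|) hY => // ->.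
  by rewrite muln0 leqn0 (gtn_eqF X_gt0).
have [s' [Y' [s'0 hs' Y'Y hY' hw]]] := amplify wP YX Y0.
pose W := sumset (dilate s' (sumset D D)) (dilate s (sumset D D)).
apply: (@pivots_intro Y' W (s * s')) => //.
- exact: subset_trans Y'Y YX.
- apply: leq_trans hY _; apply: leq_trans (leq_mul (leqnn _) hY') _.
  by rewrite mulnA mulnACA -expnD.
- by rewrite mulf_neq0.
- move=> y yY'; have -> : y * (s * s') * (v + w) =
    s' * (y * s * v) + s * (y * s' * w) by ring.
  by rewrite sumset_in // dilate_in // ?hw // hv // (subsetP Y'Y).
have mixB t : mixed t -> forall j V,
    (#|add_copies j (dilate t D) V| <=
     (tau ^ 8) ^ j * #|add_copies (j * 4) D V|)%N.
  move=> ht; apply: card_add_copies_le => V; exact: card_sumset_mixed.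
have -> : sumset W (dilate (s * s') D) =
    sumset (dilate (s * s') D)
      (add_copies 2 (dilate s' D) (add_copies 2 (dilate s D) [set 0])).
  rewrite sumsetC /W !dilate_sumset; congr sumset.
  by rewrite !add_copiesS sumset0r -!sumsetA.
(* The product s * s' need not be mixed. Scaling by the inverse of s' reduces to s, at the price of
   copies of s'D in place of [D]. *)
have step V : (#|sumset (dilate (s * s')%R D) V| <=
               tau ^ 8 * #|add_copies 4 (dilate s' D) V|)%N.
  have V' : V = dilate s' (dilate s'^-1 V) by rewrite dilateM divff ?dilate1.
  rewrite [in X in (X <= _)%N]V' [in X in (_ <= X)%N]V'.
  rewrite (mulrC s) -dilateM -dilate_sumset -dilate_add_copies.
  by rewrite !card_dilate // card_sumset_mixed.
apply: leq_trans (step _) _; rewrite -add_copiesD.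
apply: leq_trans (leq_mul (leqnn _) (mixB _ hs' _ _)) _.
rewrite add_copiesC mulnA.
apply: leq_trans (leq_mul (leqnn _) (mixB _ hs _ _)) _.
by rewrite mulnA -!expnM -!expnD -add_copiesD card_copies_small.
Qed.

Lemma pivots0 : 0 \in pivots.
Proof.
apply: (@pivots_intro X D 1) => //.
- by rewrite -[X in (X <= _)%N]mul1n leq_mul // muln_gt0 expn_gt0 tau_gt0.
- exact: oner_neq0.
- by move=> y _; rewrite mulr0 diffset0.
rewrite dilate1 (_ : sumset D D = add_copies 2 D [set 0]) //.
  by rewrite -[#|_|]mul1n (@card_copies_small 0).
by rewrite !add_copiesS sumset0r.
Qed.

Lemma pivotsN (v : L) : v \in pivots -> - v \in pivots.
Proof.
rewrite !inE => vP; apply: leq_trans vP _; apply/subset_leq_card/subsetP => p.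
move=> /setIdP[pX h]; apply/setIdP; split=> //.
by rewrite mulrN -mulN1r -(diffsetN R : _ = D) dilate_in.
Qed.

Lemma pivots_zmod : GRing.zmod_closed pivots.
Proof. by split=> [|v w vP wP]; [exact: pivots0 | rewrite pivotsD ?pivotsN]. Qed.

(** For each x, collisions of (a, u) -> xa - u give |R|^2 / tau pairs (a, b) with x(a - b) in [D].
    Summing over x and fixing a good b, at least |R| / (2 tau) of the a satisfy this for |X| / (2
    tau) values of x, which is enough for [pivots_intro] with scalar 1. *)
Lemma pivots_base : exists2 b, b \in R &
  (#|R| <= 2 * tau * #|[set a in R | (a - b)%R \in pivots]|)%N.
Proof.
pose near x (p : L * L) := x * (p.1 - p.2) \in D.
have pairs x : x \in X ->
    (#|R| ^ 2 <= tau * #|[set p in setX R R | near x p]|)%N.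
  move=> xX; have [U [UR U0 hU]] := small_dilate xX.
  have U_gt0 : (0 < #|U|)%N by rewrite card_gt0.
  set W := sumset _ _ in hU; pose g a u := x * a - u.
  have gW a u : a \in R -> u \in U -> g a u \in W.
    by move=> aR uU; rewrite /g -[- u]mulN1r sumset_in ?dilate_in.
  have g_inj a : injective (g a) by move=> u u' /addrI/oppr_inj.
  have h := near_pairs gW g_inj.
  rewrite -(leq_pmul2r U_gt0); apply: leq_trans h _.
  rewrite [X in (_ <= X)%N]mulnAC leq_mul //.
  apply/subset_leq_card/subsetP => -[a b] /setIdP[abR].
  move=> /existsP[u /andP[uU /existsP[u' /andP[u'U /eqP e]]]].
  apply/setIdP; split=> //; rewrite /near /=.
  have -> : x * (a - b) = u - u'.
    transitivity (g a u - g b u' + (u - u')); first by rewrite /g; ring.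
    by rewrite e subrr add0r.
  by rewrite diffset_in // (subsetP UR).
have tot : (#|R| * (#|R| * #|X|) <=
    tau * \sum_(b in R) \sum_(a in R) #|[set x in X | near x (a, b)]|)%N.
  have -> : (\sum_(b in R) \sum_(a in R) #|[set x in X | near x (a, b)]| =
             \sum_(x in X) #|[set p in setX R R | near x p]|)%N.
    rewrite -double_count exchange_big pair_big /=.
    by apply: eq_big => [[a b]|[a b] _]; rewrite ?inE.
  rewrite mulnA mulnn mulnC -sum_nat_const big_distrr /=.
  by apply: leq_sum => x; exact: pairs.
have [b bR hb] := avg_le R_gt0 tot; exists b => //.
have := @popular_le _ R (fun a => #|[set x in X | near x (a, b)]|) #|X| tau.
move=> /(_ X_gt0) h; apply: leq_trans (h _ hb) _.
  by move=> a _; apply/subset_leq_card/subsetP => x /setIdP[].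
rewrite leq_mul2l; apply/orP; right.
apply/subset_leq_card/subsetP => a /setIdP[aR ha]; apply/setIdP; split=> //.
apply: (@pivots_intro [set x in X | near x (a, b)] D 1) => //.
- by apply/subsetP => x /setIdP[].
- apply: leq_trans ha _; rewrite leq_mul2r; apply/orP; right.
  by rewrite leq_mul // -[X in (X <= _)%N]expn1 leq_pexp2l.
- exact: oner_neq0.
- by move=> x /setIdP[_]; rewrite mulr1.
rewrite dilate1 (_ : sumset D D = add_copies 2 D [set 0]) //.
  by rewrite -[#|_|]mul1n (@card_copies_small 0).
by rewrite !add_copiesS sumset0r.
Qed.

(** Each pair x != x' is a hit of at most |D| elements v, so hits are scarce in total, whereas
    amplification gives every pivot about |X|^2 of them. The bare threshold would lose a further
    factor of order |X|. *)
Lemma card_pivots : (#|pivots| <= 8 * tau ^ 12 * kappa ^ 13 * #|R|)%N.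
Proof.
(* This is (2 tau^2)^2 from one amplification times tau^8 kappa^12 for D + D + sD. *)
pose l := (4 * tau ^ 12 * kappa ^ 12)%N.
have l0 : (0 < l)%N by rewrite /l !(muln_gt0, expn_gt0) tau_gt0 kappa_gt0.
have each v : v \in pivots -> (#|X| ^ 2 <= l * #|hits v|)%N.
  move=> vP; have [s [Y [s0 hs YX hY hW]]] := amplify vP (subxx X) X_neq0.
  have h : (#|sumset (sumset D D) (dilate s D)| <=
            tau ^ 8 * kappa ^ 12 * #|R|)%N.
    rewrite sumsetC; apply: leq_trans (card_sumset_mixed _ hs) _.
    rewrite (_ : sumset D D = add_copies 2 D [set 0]); last first.
      by rewrite !add_copiesS sumset0r.
    rewrite -add_copiesD -mulnA leq_mul2l; apply/orP; right.
    exact: card_add_copies_diffset.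
  have h' := hits_ge YX s0 hW h.
  apply: leq_trans (_ : (2 * tau ^ 2 * #|Y|) ^ 2 <= _)%N; first by rewrite leq_sqr.
  rewrite (_ : l = 4 * tau ^ 4 * (tau ^ 8 * kappa ^ 12))%N; last first.
    by rewrite /l (expnD tau 4 8) !mulnA.
  rewrite expnMn (_ : (2 * tau ^ 2) ^ 2 = 4 * tau ^ 4)%N; last first.
    by rewrite expnMn -(expnM tau 2 2).
  by rewrite -[X in (_ <= X)%N]mulnA leq_mul2l h' orbT.
have sum_hits : (\sum_(v in pivots) #|hits v| <=
    #|X| * #|pivots| + #|X| ^ 2 * #|D|)%N.
  rewrite double_count.
  apply: leq_trans (_ : \sum_(p in setX X X)
     ((if p.1 == p.2 then #|pivots| else 0) + #|D|) <= _)%N.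
    apply: leq_sum => -[x x'] _ /=; case: eqP => [_|/eqP xx'].
      rewrite -[X in (X <= _)%N]addn0 leq_add //.
      by apply/subset_leq_card/subsetP => v /setIdP[].
    rewrite add0n -(card_dilate [set v in _ | _] (_ : x - x' != 0)) ?subr_eq0 //.
    by apply/subset_leq_card/subsetP => _ /dilateP[v /setIdP[_ h] ->].
  rewrite big_split /= sum_nat_const cardsX mulnn leq_add2r.
  rewrite -big_mkcondr /= sum_nat_cond_const leq_mul2r; apply/orP; right.
  rewrite -(card_imset (mem X) (_ : injective (fun x => (x, x)))); last first.
    by move=> x y [].
  apply/subset_leq_card/subsetP => -[x x'].
  rewrite !inE /= => /andP[/andP[xX _] /eqP<-]; exact: imset_f.
have tot : (#|pivots| * #|X| ^ 2 <=
            l * (#|X| * #|pivots| + #|X| ^ 2 * #|D|))%N.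
  apply: leq_trans (leq_mul (leqnn _) sum_hits).
  by rewrite -sum_nat_const big_distrr leq_sum.
(* Makes the diagonal pairs, which hit every pivot, at most half of the count, so they can be
   absorbed on the left. *)
have lX : (2 * l <= #|X|)%N.
  apply: leq_trans X_large.
  have tp : (tau ^ 12 <= tau ^ 82)%N by rewrite leq_pexp2l.
  have kp : (kappa ^ 12 <= kappa ^ 64)%N by rewrite leq_pexp2l.
  have -> : (2 * l = 8 * tau ^ 12 * kappa ^ 12)%N by rewrite /l; lia.
  by apply: leq_mul kp; exact: leq_mul tp.
have hP : (#|pivots| <= 2 * l * #|D|)%N.
  have XX : (0 < #|X| * #|X|)%N by rewrite muln_gt0 X_gt0.
  rewrite -(leq_pmul2l XX); move: tot lX.
  set x := #|X|; set p := #|pivots|; set d := #|D| => tot lX.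
  have : (2 * (l * (x * p)) <= x * (x * p))%N.
    by rewrite mulnA leq_mul2r lX orbT.
  move: tot; rewrite -mulnn; clearbody l; nia.
apply: leq_trans hP _.
apply: leq_trans (leq_mul (leqnn _) small_diff) _.
rewrite /l (expnS kappa 12); move: (tau ^ 12)%N (kappa ^ 12)%N => t k.
by apply/eq_leq; ring.
Qed.

Lemma pivots_subspace (F : {set L}) :
  subfield_generated X F -> is_subspace F pivots.
Proof.
move=> [_ _ Fmin]; split=> [|c v cF vP]; first exact: pivots_zmod.
have sub : X \subset [set c | dilate c pivots \subset pivots].
  apply/subsetP => x xX; rewrite inE.
  by apply/subsetP => _ /dilateP[w wP ->]; exact: pivotsM.
have := subsetP (Fmin _ (stabilizer_subfield pivots_zmod) sub) _ cF.
by rewrite inE => /subsetP; apply; exact: dilate_in.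
Qed.

End Pivot.

(** * From energy to small doubling *)

Lemma sum_card_fibre_le (I J : finType) (P : {set I}) (Y : {set J})
    (r : I -> J -> bool) :
  (forall j i i', r i j -> r i' j -> i = i') ->
  (\sum_(i in P) #|[set j in Y | r i j]| <= #|Y|)%N.
Proof.
move=> r_fun; rewrite double_count -sum1_card; apply: leq_sum => j _.
by apply/card_le1_eqP => i i' /setIdP[_ h] /setIdP[_ h']; exact: (r_fun j).
Qed.

Definition rep (L : finFieldType) (A : {set L}) (d : L) : nat :=
  #|[set p in setX A A | p.1 - p.2 == d]|.

Arguments rep [L] A d%_R.

Lemma energyE (L : finFieldType) (A : {set L}) (xi : L) :
  energy A xi = (\sum_(p in setX A A) rep A (xi * (p.1 - p.2)))%N.
Proof.
rewrite /rep double_count /energy.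
pose f (q : L * L * L * L) := ((q.1.1.1, q.1.1.2), (q.1.2, q.2)).
have f_inj : injective f by move=> [[[? ?] ?] ?] [[[? ?] ?] ?] [-> -> -> ->].
rewrite -(card_imset _ f_inj) -sum1_card.
rewrite (partition_big (fun q => q.1) (mem (setX A A))) /=.
  apply: eq_bigr => -[a1 a2] /setXP[h1 h2].
  rewrite sum1_card; set Q := [set i in setX A A | _].
  rewrite -(card_imset (mem Q) (_ : injective (pair (a1, a2)))); last first.
    by move=> ? ? [].
  apply: eq_card => -[[b1 b2] [b3 b4]]; rewrite [LHS]unfold_in /=.
  apply/andP/imsetP.
    move=> [/imsetP[[[[c1 c2] c3] c4] + [-> -> -> ->]]].
    rewrite inE => /and5P[_ _ h3 h4 e] /eqP[e1 e2]; subst.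
    by exists (c3, c4); rewrite // !inE h3 h4.
  move=> [[c3 c4] /setIdP[/setXP[h3 h4] /= e] [-> -> -> ->]].
  split=> //; apply/imsetP; exists (a1, a2, c3, c4) => //.
  by rewrite inE h1 h2 h3 h4.
move=> _ /imsetP[[[[c1 c2] c3] c4] + ->]; rewrite inE => /and5P[h1 h2 _ _ _].
by rewrite /= in_setX h1.
Qed.

(** The shifts t correspond to the pairs (xi p.1 + t, xi p.2 + t). This turns the energy into the
    second moment of the fibres used in [bsg]. *)
Lemma rep_dilate (L : finFieldType) (A : {set L}) (xi : L) (p : L * L) :
  #|[set t in [set: L] | (xi * p.1 + t \in A) && (xi * p.2 + t \in A)]| =
  rep A (xi * (p.1 - p.2)).
Proof.
rewrite /rep; set S := [set t in _ | _].
rewrite -(card_imset (mem S) (_ : injective (fun t => (xi * p.1 + t, xi * p.2 + t)))).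
  apply: eq_card => -[a b]; apply/imsetP/setIdP.
    move=> [t /setIdP[_ /andP[h h']] [-> ->]]; split; first exact/setXP.
    by apply/eqP => /=; ring.
  move=> [/setXP[aA bA] /= /eqP e]; exists (a - xi * p.1).
    apply/setIdP; split=> //; rewrite addrC subrK aA /=.
    have -> // : xi * p.2 + (a - xi * p.1) = b.
    by rewrite -[b](subrK a) -(opprB a b) e; ring.
  congr (_, _); first by ring.
  by rewrite -[b](subrK a) -(opprB a b) e; ring.
by move=> t t' [/addrI].
Qed.

(* Schoen's form of the Balog-Szemeredi-Gowers theorem: most pairs of a typical
   popular fibre [{b in A | xi b + t in A}] have a popular difference. *)
Lemma bsg (L : finFieldType) (A : {set L}) (xi : L) (k : nat) :
  A != set0 -> xi != 0 -> (#|A| ^ 3 <= k * energy A xi)%N ->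
  exists (R : {set L}) (t : L),
    [/\ R \subset A, (forall b, b \in R -> xi * b + t \in A),
        (#|A| <= 12 * k * #|R|)%N
      & (#|diffset R| <= 4 ^ 5 * k ^ 3 * #|A|)%N].
Proof.
rewrite -card_gt0 => A_gt0 xi0 hE.
pose F t := [set b in A | xi * b + t \in A].
pose bad (p : L * L) := (8 * k * rep A (p.1 - p.2) < #|A|)%N.
pose nbad t := #|[set p in setX A A | [&& xi * p.1 + t \in A,
                     xi * p.2 + t \in A & bad p]]|.
have sumF : (\sum_(t in [set: L]) #|F t| <= #|A| ^ 2)%N.
  rewrite double_count -mulnn -sum_nat_const; apply: leq_sum => b _.
  rewrite -(card_imset _ (@addrI _ (xi * b))).
  by apply/subset_leq_card/subsetP => _ /imsetP[t /setIdP[_ h] ->].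
have sumF2 : (\sum_(t in [set: L]) #|F t| ^ 2 = energy A xi)%N.
  rewrite energyE -(eq_bigr _ (fun p _ => rep_dilate A xi p)) -double_count.
  apply: eq_bigr => t _; rewrite -mulnn -cardsX; apply: eq_card => -[b b'].
  apply/setXP/setIdP.
    by move=> [/setIdP[bA h] /setIdP[b'A h']]; rewrite h h'; split; first exact/setXP.
  by move=> [/setXP[bA b'A] /andP[h h']]; split; apply/setIdP.
(* Regroup by the shifted pair q in A x A: all p belonging to q share one difference, and if it is
   bad there are fewer than |A| / (8k) of them. *)
have sumbad : (8 * k * \sum_(t in [set: L]) nbad t <= #|A| ^ 3)%N.
  rewrite /nbad -double_count.
  have -> : (\sum_(p in setX A A) #|[set t in [set: L] |
      [&& (xi * p.1 + t)%R \in A, (xi * p.2 + t)%R \in A & bad p]]| =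
      \sum_(p in setX A A) #|[set q in setX A A |
        ((q.1 - q.2)%R == (xi * (p.1 - p.2))%R) && bad p]|)%N.
    apply: eq_bigr => p _; case hp : (bad p); last first.
      by transitivity 0%N; [|symmetry]; apply/eqP; rewrite cards_eq0;
      apply/eqP/setP => q; rewrite in_set0; apply/setIdP => -[_];
      rewrite !andbF.
    have := rep_dilate A xi p; rewrite /rep => e.
    transitivity #|[set t in [set: L] | (xi * p.1 + t \in A) && (xi * p.2 + t \in A)]|.
      by apply: eq_card => t; rewrite !inE andbT.
    by rewrite e; apply: eq_card => q; rewrite !inE andbT.
  rewrite double_count big_distrr /=.
  rewrite (_ : #|A| ^ 3 = #|setX A A| * #|A|)%N; last first.
    by rewrite cardsX mulnn mulnC -expnS.
  rewrite -sum_nat_const; apply: leq_sum => q _.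
  set S := [set p in _ | _].
  have [->|/set0Pn[p /setIdP[_ /andP[/eqP e hp]]]] := eqVneq S set0.
    by rewrite cards0 muln0.
  apply: leq_trans (ltnW hp); rewrite leq_mul2l; apply/orP; right.
  apply/subset_leq_card/subsetP => p' /setIdP[p'A /andP[/eqP e' _]].
  apply/setIdP; split=> //; apply/eqP/(mulfI xi0).
  by rewrite -e -e'.
(* Summed over t, the right side is at least 4 |A|^3 and the left at most 2 |A|^3 + |A|^3. One t
   thus has both few bad pairs, at most |F t|^2 / 4, and a large fibre, at least |A| / (4k). *)
have [t ht] : exists t, (16 * k * nbad t + #|A| * #|F t| < 4 * k * #|F t| ^ 2)%N.
  case: (pselect (exists t, 16 * k * nbad t + #|A| * #|F t| < 4 * k * #|F t| ^ 2)%N) => //.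
  move=> /forallNP hn; exfalso.
  have : (\sum_(t in [set: L]) 4 * k * #|F t| ^ 2 <=
          \sum_(t in [set: L]) (16 * k * nbad t + #|A| * #|F t|))%N.
    by apply: leq_sum => t _; have /negP := hn t; rewrite -leqNgt.
  rewrite big_split /= -!big_distrr /= sumF2 => h.
  have h1 : (#|A| * \sum_(t in [set: L]) #|F t| <= #|A| ^ 3)%N.
    by rewrite (expnS _ 2) leq_mul2l sumF orbT.
  have A3 : (0 < #|A| ^ 3)%N by rewrite expn_gt0 A_gt0.
  move: h h1 A3 sumbad hE; clear.
  move: (#|A| ^ 3)%N (\sum_(t in _) nbad t)%N (energy A xi) => a3 nb E.
  rewrite -!mulnA; move: (k * E)%N (k * nb)%N (#|A| * _)%N => kE kb s.
  lia.
set f := #|F t| in ht.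
have f_gt0 : (0 < f)%N by move: ht; case: f => // /[!muln0].
have k_gt0 : (0 < k)%N.
  by case: (posnP k) ht => // ->; rewrite muln0 mul0n ltn0.
pose badb b := [set c in F t | bad (b, c)].
have nbadE : nbad t = (\sum_(b in F t) #|badb b|)%N.
  rewrite /nbad -sum1_card (partition_big (fun p => p.1) (mem (F t))) /=.
    apply: eq_bigr => b bF; rewrite sum1_card.
    rewrite -(card_imset (mem (badb b)) (_ : injective (pair b))); last by move=> ? ? [].
    have /setIdP[bA bA'] := bF.
    apply: eq_card => -[b' c]; rewrite [LHS]unfold_in /=; apply/andP/imsetP.
      move=> [/setIdP[/setXP[_ cA] /and3P[_ cA' bc]] /eqP /= e].
      rewrite e in bc *; exists c => //.
      by apply/setIdP; split=> //; apply/setIdP.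
    move=> [c' /setIdP[/setIdP[cA cA'] bc] [-> ->]]; split=> //.
    by apply/setIdP; split; [exact/setXP | rewrite bA' cA'].
  by move=> [b c] /setIdP[/setXP[bA _] /and3P[h _ _]]; apply/setIdP.
(* The ratio 3/8 lies between 1/4, the average share of bad partners, so that a third of the fibre
   survives, and 1/2, so that any two survivors keep f / 4 common good partners. *)
pose R := [set b in F t | 8 * #|badb b| <= 3 * f]%N.
have RF : R \subset F t by apply/subsetP => b /setIdP[].
have Rlarge : (f <= 3 * #|R|)%N.
  have : (\sum_(b in F t) (if b \in R then 0 else 3 * f) <= 8 * nbad t)%N.
    rewrite nbadE big_distrr /=; apply: leq_sum => b bF.
    by case: ifP => // /negbT; rewrite in_set bF /= -ltnNge => /ltnW.
  have -> : (\sum_(b in F t) (if b \in R then 0 else 3 * f) =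
             #|F t :\: R| * (3 * f))%N.
    rewrite -sum_nat_const [RHS]big_mkcond [LHS]big_mkcond /=.
    by apply: eq_bigr => b _; rewrite in_setD; case: (b \in R); case: (b \in F t).
  rewrite cardsD (setIidPr RF) -/f => h.
  have Rf : (#|R| <= f)%N by exact: subset_leq_card.
  have h2 : (4 * nbad t <= f ^ 2)%N.
    rewrite -(leq_pmul2l k_gt0) mulnCA; move: ht; rewrite -!mulnA.
    by move: (k * nbad t)%N (k * f ^ 2)%N (#|A| * f)%N => x y z; lia.
  have : (3 * f * (f - #|R|) <= f * (2 * f))%N by nia.
  by rewrite mulnAC [X in (_ <= X)%N]mulnC leq_pmul2r //; lia.
have fA : (#|A| <= 4 * k * f)%N.
  have : (#|A| * f <= 4 * k * f * f)%N by rewrite -mulnA mulnn; lia.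
  by rewrite leq_pmul2r.
exists R, t; split.
- by apply: subset_trans RF _; apply/subsetP => b /setIdP[].
- by move=> b /(subsetP RF)/setIdP[].
- apply: leq_trans fA _; nia.
pose S4 := setX (setX A A) (setX A A).
pose dd (q : (L * L) * (L * L)) := (q.1.1 - q.1.2) - (q.2.1 - q.2.2).
(* For a common good partner c, d = (b - c) - (b' - c), and each bracket has at least |A| / (8k)
   representations; distinct c give distinct quadruples. *)
have many d : d \in diffset R ->
    (f * #|A| ^ 2 <= 256 * k ^ 2 * #|[set q in S4 | dd q == d]|)%N.
  move=> /diffsetP[b [b' [bR b'R ->]]]; set S4d := [set q in S4 | _].
  pose C := F t :\: (badb b :|: badb b').
  have C_large : (f <= 4 * #|C|)%N.
    have : (#|C| + #|badb b :|: badb b'| >= f)%N.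
      rewrite addnC /C cardsD -/f; have := subset_leq_card (subsetIr (F t) (badb b :|: badb b')).
      lia.
    have := cardsU (badb b) (badb b').
    move: bR b'R => /setIdP[_ h] /setIdP[_ h']; lia.
  pose r c (q : (L * L) * (L * L)) := (q.1.1 - q.1.2 == b - c) && (q.2.1 - q.2.2 == b' - c).
  have each c : c \in C -> (#|A| ^ 2 <= 64 * k ^ 2 * #|[set q in S4d | r c q]|)%N.
    move=> /setDP[cF]; rewrite !inE; move: cF; rewrite inE => -> /=.
    rewrite negb_or /bad -!leqNgt /= => /andP[h h'].
    apply: leq_trans (_ : (8 * k * rep A (b - c)) * (8 * k * rep A (b' - c)) <= _)%N.
      by rewrite -mulnn leq_mul.
    rewrite mulnACA (_ : 8 * k * (8 * k) = 64 * k ^ 2)%N; last by lia.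
    rewrite leq_mul2l -cardsX; apply/orP; right.
    apply/subset_leq_card/subsetP => -[p q] /setXP[/setIdP[pA e] /setIdP[qA e']].
    apply/setIdP; split; last by rewrite /r e e'.
    apply/setIdP; split; first exact/setXP.
    by rewrite /dd /= (eqP e) (eqP e'); apply/eqP; ring.
  have total : (\sum_(c in C) #|[set q in S4d | r c q]| <= #|S4d|)%N.
    apply: sum_card_fibre_le => q c c' /andP[/eqP e _] /andP[/eqP e' _].
    by move: e'; rewrite e => /addrI/oppr_inj.
  have : (#|C| * #|A| ^ 2 <= 64 * k ^ 2 * #|S4d|)%N.
    apply: leq_trans (leq_mul (leqnn _) total).
    by rewrite -sum_nat_const big_distrr leq_sum.
  have : (f * #|A| ^ 2 <= 4 * #|C| * #|A| ^ 2)%N by rewrite leq_mul2r C_large orbT.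
  lia.
have total : (#|diffset R| * (f * #|A| ^ 2) <= 256 * k ^ 2 * #|A| ^ 4)%N.
  have -> : (#|A| ^ 4 = #|S4|)%N by rewrite !cardsX !mulnn -expnM.
  have : (\sum_(d in diffset R) #|[set q in S4 | dd q == d]| <= #|S4|)%N.
    by apply: sum_card_fibre_le => q d d' /eqP <- /eqP.
  move=> /(leq_mul (leqnn (256 * k ^ 2)%N)); apply: leq_trans.
  by rewrite -sum_nat_const big_distrr leq_sum.
have A3 : (0 < #|A| ^ 3)%N by rewrite expn_gt0 A_gt0.
rewrite -(leq_pmul2r A3).
apply: leq_trans (_ : #|diffset R| * (4 * k * f * #|A| ^ 2) <= _)%N.
  by rewrite leq_mul2l (expnS _ 2) leq_mul2r fA !orbT.
move: total; set d := #|diffset R|; rewrite (expnS _ 3) (expnS k 2) => total.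
have : (4 * k * (d * (f * #|A| ^ 2)) <=
        4 * k * (256 * k ^ 2 * (#|A| * #|A| ^ 3)))%N by rewrite leq_mul2l total orbT.
move: (#|A| ^ 2)%N (#|A| ^ 3)%N (k ^ 2)%N => a2 a3 k2.
by rewrite (_ : 4 ^ 5 = 4 * 256)%N //; lia.
Qed.

(* Cauchy-Schwarz over the sets [(xi R_xi + t_xi) x R_xi]: some [x0] in [X] has
   a large intersection with many [xi], and then Ruzsa's triangle inequality
   through [x R_xi] compares [R := R_x0] with its dilate by [x := xi / x0]. *)
Lemma common_structure (L : finFieldType) (A X : {set L}) (a b k : nat) :
  A != set0 -> X != set0 -> 0 \notin X ->
  (forall xi, xi \in X -> exists (R : {set L}) (t : L),
     [/\ R \subset A, (forall r, r \in R -> (xi * r + t)%R \in A),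
         #|A| <= a * k * #|R| & #|diffset R| <= b * k ^ 3 * #|A|]%N) ->
  exists (x0 : L) (R X' : {set L}),
    [/\ x0 \in X, R \subset A /\ X' \subset dilate x0^-1 X,
        [/\ #|A| <= a * k * #|R|, #|X| <= 2 * (a * k) ^ 4 * #|X'|
          & #|diffset R| <= b * a * k ^ 4 * #|R|]%N
      & forall x, x \in X' -> exists U : {set L},
          [/\ U \subset R, U != set0
            & #|sumset (dilate x R) (dilate (-1)%R U)| <=
              2 * a ^ 4 * b ^ 2 * k ^ 10 * #|U|]%N].
Proof.
move=> A0 X0 Xu hyp; have A_gt0 : (0 < #|A|)%N by rewrite card_gt0.
have /choice[w hw] : forall xi, exists p : {set L} * L, xi \in X ->
    [/\ p.1 \subset A, (forall r, r \in p.1 -> (xi * r + p.2)%R \in A),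
         #|A| <= a * k * #|p.1| & #|diffset p.1| <= b * k ^ 3 * #|A|]%N.
  move=> xi; case: (boolP (xi \in X)) => [/hyp[R [t h]]|_]; first by exists (R, t).
  by exists (set0, 0%R).
pose im xi := [set xi * r + (w xi).2 | r in (w xi).1].
(* Pairing the translated dilate with [R] itself lets one intersection of rectangles control two
   overlaps at once: of the images in [A], and of the sets R_xi and R_x0. *)
pose G xi := setX (im xi) (w xi).1.
have Xn0 xi : xi \in X -> xi != 0.
  by move=> xiX; apply: contraNneq Xu => <-.
have card_im xi : xi \in X -> #|im xi| = #|(w xi).1|.
  move=> /Xn0 xi0; apply: card_imset => r r' /addIr; exact: mulfI.
have GA xi : xi \in X -> G xi \subset setX A A.
  move=> /hw[h1 h2 _ _]; apply/subsetP => -[c d] /setXP[/imsetP[r rR ->] dR].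
  by apply/setXP; split; [exact: h2 | exact: (subsetP h1)].
have Glarge xi : xi \in X -> (#|A| ^ 2 <= (a * k) ^ 2 * #|G xi|)%N.
  move=> xiX; have [_ _ h _] := hw _ xiX.
  by rewrite cardsX card_im // mulnn -expnMn leq_sqr.
pose I2 := (\sum_(x0 in X) \sum_(xi in X) #|G xi :&: G x0|)%N.
have cs : (#|X| * (#|X| * #|A| ^ 2) <= (a * k) ^ 4 * I2)%N.
  pose deg g := #|[set xi in X | g \in G xi]|.
  have sum_deg : (\sum_(g in setX A A) deg g = \sum_(xi in X) #|G xi|)%N.
    rewrite double_count; apply: eq_bigr => xi xiX.
    apply: eq_card => g; rewrite in_set andb_idl //.
    exact: (subsetP (GA _ xiX)).
  have sum_deg2 : (\sum_(g in setX A A) deg g ^ 2 = I2)%N.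
    rewrite /I2 pair_big /=.
    have -> : (\sum_(g in setX A A) deg g ^ 2 = \sum_(g in setX A A)
        #|[set p in setX X X | (g \in G p.2) && (g \in G p.1)]|)%N.
      apply: eq_bigr => g _; rewrite /deg -mulnn -cardsX; apply: eq_card => -[x y].
      apply/setXP/setIdP => /=.
        by move=> [/setIdP[xX ->] /setIdP[yX ->]]; split; first exact/setXP.
      by move=> [/setXP[xX yX] /andP[h h']]; split; apply/setIdP.
    rewrite double_count; apply: eq_big => [[x y]|[x y]]; first by rewrite in_setX.
    move=> /setXP[xX yX]; apply: eq_card => g.
    rewrite in_set in_setI andb_idl // => /andP[_].
    exact: (subsetP (GA _ xX)).
  have h1 : (#|X| * #|A| ^ 2 <= (a * k) ^ 2 * \sum_(xi in X) #|G xi|)%N.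
    by rewrite -sum_nat_const big_distrr leq_sum.
  have := sum_sqr_le (setX A A) deg; rewrite sum_deg sum_deg2 cardsX mulnn => h2.
  have A2 : (0 < #|A| ^ 2)%N by rewrite expn_gt0 A_gt0.
  rewrite -(leq_pmul2r A2).
  apply: leq_trans (_ : (#|X| * #|A| ^ 2) ^ 2 <= _)%N.
    by move: (#|A| ^ 2)%N => y; rewrite -(mulnn (_ * y)%N); apply/eq_leq; ring.
  apply: leq_trans (_ : ((a * k) ^ 2 * \sum_(xi in X) #|G xi|) ^ 2 <= _)%N.
    by rewrite leq_sqr.
  rewrite expnMn -(expnM _ 2 2) -mulnA leq_mul2l; apply/orP; right.
  by rewrite mulnC.
have X_gt0 : (0 < #|X|)%N by rewrite card_gt0.
have [x0 x0X hx0] := avg_le X_gt0 cs.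
have A2 : (0 < #|A| ^ 2)%N by rewrite expn_gt0 A_gt0.
have Gle xi : xi \in X -> (#|G xi :&: G x0| <= #|A| ^ 2)%N.
  move=> xiX; rewrite -mulnn -cardsX subset_leq_card //.
  exact: subset_trans (subsetIl _ _) (GA _ xiX).
have popX := popular_le A2 Gle hx0.
set X2 := [set xi in X | _] in popX.
have x00 := Xn0 _ x0X.
have [R0A R0im R0large R0small] := hw _ x0X; set R0 := (w x0).1 in R0A R0im R0large R0small.
have R0_gt0 : (0 < #|R0|)%N.
  by case: (posnP #|R0|) R0large => // ->; rewrite muln0 leqn0 (gtn_eqF A_gt0).
exists x0, R0, (dilate x0^-1 X2); split=> //.
- by split=> //; apply: dilateS; apply/subsetP => x /setIdP[].
- split=> //; first by rewrite card_dilate ?invr_eq0.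
  apply: leq_trans R0small _.
  apply: leq_trans (leq_mul (leqnn _) R0large) _.
  rewrite (expnS k 3); move: (k ^ 3)%N => k3; apply/eq_leq; ring.
move=> _ /dilateP[xi /setIdP[xiX hxi] ->]; set x := x0^-1 * xi.
have [RA Rim Rlarge Rsmall] := hw _ xiX.
pose U := [set u in R0 | x0 * u + (w x0).2 \in im xi].
pose S := (w xi).1 :&: R0.
have US : (#|A| ^ 2 <= 2 * (a * k) ^ 4 * (#|U| * #|S|))%N.
  apply: leq_trans hxi _; rewrite leq_mul2l; apply/orP; right.
  rewrite -cardsX; apply: leq_trans (leq_imset_card
    (fun p : L * L => (x0 * p.1 + (w x0).2, p.2)) _).
  apply/subset_leq_card/subsetP => -[c d] /setIP[/setXP[h1 h2] /setXP[h3 h4]].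
  move: h3 => /imsetP[u uR0 e]; apply/imsetP; exists (u, d); last by rewrite e.
  by apply/setXP; split; [apply/setIdP; rewrite -e | apply/setIP].
have [U_gt0 S_gt0] : (0 < #|U| /\ 0 < #|S|)%N.
  by move: A2 US; case: #|U| => [|u]; case: #|S| => [|s];
    rewrite ?muln0 ?mul0n ?muln0 // => h; rewrite leqNgt h.
have x_neq0 : x != 0 by rewrite mulf_neq0 ?invr_eq0 // Xn0.
exists U; split; [by apply/subsetP => u /setIdP[] | by rewrite -card_gt0 |].
(* An element u of [U] has the form xr + const with r in R_xi, so xs - u = x(s - r) - const stays in
   an affine image of R_xi - R_xi. *)
have h1 : (#|sumset (dilate (-1)%R U) (dilate x S)| <= b * k ^ 3 * #|A|)%N.
  apply: leq_trans Rsmall.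
  apply: leq_trans (leq_imset_card
    (fun d => x * d + x0^-1 * ((w x0).2 - (w xi).2)) _).
  apply/subset_leq_card/subsetP => _ /sumsetP[_ [_ [/dilateP[u + ->] /dilateP[s + ->] ->]]].
  move=> /setIdP[uR0 /imsetP[r rR e]] /setIP[sR _].
  apply/imsetP; exists (s - r); first exact: diffset_in.
  have -> : u = x0^-1 * (xi * r + (w xi).2 - (w x0).2).
    by rewrite -e addrK mulKf.
  by rewrite /x; ring.
have h2 : (#|sumset (dilate x R0) (dilate (-1)%R (dilate x S))| <= b * k ^ 3 * #|A|)%N.
  apply: leq_trans R0small; rewrite -[X in (_ <= X)%N](card_dilate _ x_neq0).
  rewrite dilate_diffset /diffset subset_leq_card // sumsetS // !dilateS //.
  exact: subsetIr.
have := ruzsa_triangle (dilate x S) (dilate (-1) U) (dilate x R0).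
rewrite card_dilate // (sumsetC (dilate (-1) U) (dilate x R0)) => h.
rewrite -(leq_pmul2l S_gt0); apply: leq_trans h _.
apply: leq_trans (leq_mul h1 h2) _.
rewrite mulnACA mulnn.
apply: leq_trans (leq_mul (leqnn _) US) _.
rewrite (expnD k 6 4) (expnM k 3 2) !expnMn -!mulnn.
move: (k ^ 3)%N (k ^ 4)%N (a ^ 4)%N => k3 k4 a4; apply/eq_leq; ring.
Qed.

(* [a] and [b] stand for the constants of [bsg]; they are kept abstract so that
   the large numerals built from them are never evaluated. *)
Lemma structure_nat_param (a b : nat) :
  (forall (L : finFieldType) (A : {set L}) (xi : L) (k : nat),
    A != set0 -> xi != 0 -> (#|A| ^ 3 <= k * energy A xi)%N ->
    exists (R : {set L}) (t : L),
      [/\ R \subset A, (forall r, r \in R -> (xi * r + t)%R \in A),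
          #|A| <= a * k * #|R| & #|diffset R| <= b * k ^ 3 * #|A|]%N) ->
  exists2 c : nat, (0 < c)%N &
  forall (L : finFieldType) (A X : {set L}) (k : nat),
    A != set0 -> X != set0 -> 0 \notin X ->
    (forall xi, xi \in X -> (#|A| ^ 3 <= k * energy A xi)%N) ->
    (c * k ^ 1080 <= #|X|)%N ->
    exists (abar x0 : L) (F V A1 X' : {set L}),
      [/\ abar \in A /\ x0 \in X,
          A1 \subset translate A abar /\ X' \subset dilate x0^-1 X,
          is_subspace F V,
          subfield_generated X' F /\ subspace_generated F A1 V
        & [/\ #|A| <= c * k ^ 11 * #|A1|, #|X| <= c * k ^ 4 * #|X'|
            & #|V| <= c * k ^ 182 * #|A1|]%N].
Proof.
move=> bsg_ab; pose s := (2 * a ^ 4)%N; pose u := (s * b ^ 2)%N; pose v := (b * a)%N.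
pose Q := (32 * (u ^ 82 * v ^ 64))%N.
pose c := (s * Q + 2 * a * u + 16 * (u ^ 13 * v ^ 13) + s).+1%N.
have [cQ c1 c2 cs] : [/\ s * Q <= c, 2 * a * u <= c,
    16 * (u ^ 13 * v ^ 13) <= c & s <= c]%N.
  rewrite /c; move: (s * Q)%N (2 * a * u)%N (16 * _)%N => x y z.
  by clear; split; lia.
have c_gt0 : (0 < c)%N by [].
exists c => //; move: c c_gt0 cQ c1 c2 cs => c c_gt0 cQ c1 c2 cs.
move=> L A X k A0 X0 Xu hE Xlarge.
have [] := @common_structure L A X a b k A0 X0 Xu.
  by move=> xi xiX; apply: bsg_ab => //; [apply: contraNneq Xu => <- | exact: hE].
move=> x0 [R [X' [x0X [RA X'X] [AR XX' Rsmall] hX']]].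
have A_gt0 : (0 < #|A|)%N by rewrite card_gt0.
have X_gt0 : (0 < #|X|)%N by rewrite card_gt0.
have k_gt0 : (0 < k)%N.
  by case: (posnP k) AR => // ->; rewrite muln0 mul0n leqn0 (gtn_eqF A_gt0).
have R0 : R != set0.
  by apply: contraTneq AR => ->; rewrite cards0 muln0 -ltnNge.
have X'0 : X' != set0.
  by apply: contraTneq XX' => ->; rewrite cards0 muln0 -ltnNge.
have {}XX' : (#|X| <= s * k ^ 4 * #|X'|)%N.
  by apply: leq_trans XX' _; rewrite /s expnMn !mulnA.
pose tau := (u * k ^ 10)%N; pose kappa := (v * k ^ 4)%N.
have smallR : (#|diffset R| <= kappa * #|R|)%N by [].
have smallX x : x \in X' -> exists U : {set L},
    [/\ U \subset R, U != set0
      & #|sumset (dilate x R) (dilate (-1)%R U)| <= tau * #|U|]%N.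
  by move=> /hX'[U [h1 h2 h3]]; exists U; split.
clear hX' Rsmall; clearbody u v s.
have sk : (0 < s * k ^ 4)%N.
  by move: (leq_trans X_gt0 XX'); rewrite muln_gt0 => /andP[].
have X'large : (32 * tau ^ 82 * kappa ^ 64 <= #|X'|)%N.
  rewrite -(leq_pmul2l sk); apply: leq_trans XX'; apply: leq_trans Xlarge.
  (* The factor k^4 pays for passing from [X] to [X']; the rest is the size demanded by the pivot
     argument. *)
  have -> : (s * k ^ 4 * (32 * tau ^ 82 * kappa ^ 64) = s * Q * k ^ 1080)%N.
    rewrite (_ : 1080 = 4 + (10 * 82 + 4 * 64))%N // !expnD !expnM.
    rewrite /tau /kappa /Q !expnMn.
    move: ((k ^ 10) ^ 82)%N ((k ^ 4) ^ 64)%N (k ^ 4)%N (u ^ 82)%N (v ^ 64)%N.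
    move=> ? ? ? ? ?; ring.
  by rewrite leq_mul2r cQ orbT.
have [abar abarR hb] := pivots_base R0 X'0 smallR smallX X'large.
have cP := card_pivots R0 X'0 smallR smallX X'large.
have subP := pivots_subspace R0 X'0 smallR smallX X'large.
set P := pivots R X' tau in hb cP subP.
set A2 := [set r in R | _] in hb; pose A1 := translate A2 abar.
have cardA1 : #|A1| = #|A2| by apply: card_imset; exact: addIr.
have [F genF] := subfield_generated_exists X'.
have [V genV] := subspace_generated_exists F A1.
have VP : V \subset P.
  have [_ _] := genV; apply; first exact: subP.
  by apply/subsetP => _ /imsetP[r /setIdP[_ h] ->].
exists abar, x0, F, V, A1, X'; split=> //.
- by split=> //; exact: (subsetP RA).
- split=> //; apply: imsetS; apply: subset_trans RA.
  by apply/subsetP => r /setIdP[].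
- by have [] := genV.
have {}hb : (#|R| <= 2 * u * k ^ 10 * #|A1|)%N by rewrite cardA1 -(mulnA 2).
split.
- apply: leq_trans AR _; apply: leq_trans (leq_mul (leqnn _) hb) _.
  have -> : (a * k * (2 * u * k ^ 10 * #|A1|) = 2 * a * u * (k ^ 11 * #|A1|))%N.
    by rewrite (expnS k 10); move: (k ^ 10)%N => k10; ring.
  by rewrite -[X in (_ <= X)%N]mulnA leq_mul2r c1 orbT.
- by apply: leq_trans XX' _; rewrite leq_mul2r leq_mul2r cs !orbT.
apply: leq_trans (subset_leq_card VP) _; apply: leq_trans cP _.
apply: leq_trans (leq_mul (leqnn _) hb) _.
have -> : (8 * tau ^ 12 * kappa ^ 13 * (2 * u * k ^ 10 * #|A1|) =
           16 * (u ^ 13 * v ^ 13) * (k ^ 182 * #|A1|))%N.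
  rewrite (_ : 182 = 10 * 12 + 10 + 4 * 13)%N // !(expnD k) !(expnM k).
  rewrite /tau /kappa !expnMn (expnS u 12).
  move: ((k ^ 10) ^ 12)%N ((k ^ 4) ^ 13)%N (k ^ 10)%N (u ^ 12)%N (v ^ 13)%N.
  move=> ? ? ? ? ?; ring.
by rewrite -[X in (_ <= X)%N]mulnA leq_mul2r c2 orbT.
Qed.

(** * Real parameters *)

Lemma structure_nat : exists2 c : nat, (0 < c)%N &
  forall (L : finFieldType) (A X : {set L}) (k : nat),
    A != set0 -> X != set0 -> 0 \notin X ->
    (forall xi, xi \in X -> (#|A| ^ 3 <= k * energy A xi)%N) ->
    (c * k ^ 1080 <= #|X|)%N ->
    exists (abar x0 : L) (F V A1 X' : {set L}),
      [/\ abar \in A /\ x0 \in X,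
          A1 \subset translate A abar /\ X' \subset dilate x0^-1 X,
          is_subspace F V,
          subfield_generated X' F /\ subspace_generated F A1 V
        & [/\ #|A| <= c * k ^ 11 * #|A1|, #|X| <= c * k ^ 4 * #|X'|
            & #|V| <= c * k ^ 182 * #|A1|]%N].
Proof. by apply: (@structure_nat_param 12 (4 ^ 5)) => L A xi k; exact: bsg. Qed.

(** Both cases are treated together: j = 0 when every element of [X] has large energy, j = 1 when
    only a subset [X1] of proportion 1 / (4K) does. The integer m stands in for K. *)
Lemma subspace_structure_of_nat (R : realType) : exists2 B : R, 1 <= B &
  forall (L : finFieldType) (A X X1 : {set L}) (K M : R) (m j : nat),
    A != set0 -> X != set0 -> 0 \notin X -> X1 \subset X ->
    1 <= K -> B <= M -> m%:R <= 4 * K -> (j <= 1)%N ->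
    #|X|%:R <= (4 * K) ^+ j * #|X1|%:R ->
    (forall xi, xi \in X1 -> (#|A| ^ 3 <= m * energy A xi)%N) ->
    M * K ^+ (1504 + j) <= #|X|%:R ->
    subspace_structure A X K M (4 + j).
Proof.
have [c c_gt0 main] := structure_nat; pose B : R := c%:R * 4 ^+ 1081.
have c1 : 1 <= c%:R :> R by rewrite ler1n.
have four1 : 1 <= (4 : R) by rewrite ler1n.
have B1 : 1 <= B by apply: mulr_ege1 => //; exact: exprn_ege1.
exists B => // L A X X1 K M m j A0 X0 Xu X1X K1 BM mK j1 XX1 hE Xlarge.
have K0 : 0 < K := lt_le_trans ltr01 K1.
have M0 : 0 < M := lt_le_trans ltr01 (le_trans B1 BM).
have K4 : 1 <= 4 * K by apply: mulr_ege1.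
(* The powers of 4 disappear into [B]; 1081 is 1080 plus the largest j. *)
have bound i e : (i <= 1081)%N -> (i <= e)%N -> c%:R * (4 * K) ^+ i <= M * K ^+ e.
  move=> i1 ie; rewrite exprMn mulrA ler_pM ?mulr_ge0 ?exprn_ge0 ?(ltW K0) //.
    by apply: le_trans BM; rewrite ler_pM ?exprn_ge0 // ler_weXn2l.
  by rewrite ler_weXn2l.
have mX i : m%:R ^+ i <= (4 * K) ^+ i.
  by apply: lerXn2r; rewrite ?nnegrE ?ler0n ?(le_trans ler01 K4).
have below (e i x y : nat) : (i <= 1081)%N -> (i <= e)%N ->
    y%:R <= c%:R * (4 * K) ^+ i * x%:R -> M^-1 * (K ^- e * y%:R) <= x%:R.
  move=> i1 ie h; rewrite ler_pdivrMl // ler_pdivrMl ?exprn_gt0 // mulrCA.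
  by apply: le_trans h _; rewrite mulrA ler_wpM2r // bound.
have Xlarge1 : (c * m ^ 1080 <= #|X1|)%N.
  rewrite -(ler_nat R) natrM natrX.
  have p : 0 < (4 * K) ^+ j by rewrite exprn_gt0 // mulr_gt0.
  rewrite -(ler_pM2l p); apply: le_trans XX1; apply: le_trans Xlarge.
  apply: le_trans (_ : c%:R * (4 * K) ^+ (1080 + j) <= _); last first.
    exact: bound (leq_add (leqnn 1080) j1)
      (leq_add (isT : 1080 <= 1504)%N (leqnn j)).
  by rewrite mulrCA addnC exprD !ler_pM2l ?ltr0n ?mX.
have X10 : X1 != set0.
  apply: contraTneq XX1 => ->; rewrite cards0 mulr0 -ltNge ltr0n card_gt0 //.
have X1u : 0 \notin X1 by apply: contra Xu; exact: (subsetP X1X).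
have [abar [x0 [F [V [A1 [X' [[abarA x0X] [A1A X'X] FV [genF genV]]]]]]]] :=
  main L A X1 m A0 X10 X1u hE Xlarge1.
move=> [hA hX hV]; exists abar, F, V.
have A1V : A1 \subset V by have [] := genV.
have A1le : #|A1|%:R <= #|V :&: translate A abar|%:R :> R.
  by rewrite ler_nat subset_leq_card // subsetI A1V.
have natb (i x y : nat) : (y <= c * m ^ i * x)%N ->
    y%:R <= c%:R * (4 * K) ^+ i * x%:R.
  rewrite -(ler_nat R) !natrM natrX => h; apply: le_trans h _.
  by rewrite ler_wpM2r // ler_wpM2l ?mX.
have hA' : M^-1 * (K ^- 85 * #|A|%:R) <= #|A1|%:R.
  by apply: (below _ 11) => //; exact: natb.
have hV' : M^-1 * (K ^- 704 * #|V|%:R) <= #|A1|%:R.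
  by apply: (below _ 182) => //; exact: natb.
have hX' : M^-1 * (K ^- (4 + j) * #|X|%:R) <= #|X'|%:R.
  apply: (below _ (4 + j)%N) => //; first exact: leq_trans (leq_add (leqnn 4) j1) _.
  have -> : c%:R * (4 * K) ^+ (4 + j) * #|X'|%:R =
      (4 * K) ^+ j * (c%:R * (4 * K) ^+ 4 * #|X'|%:R).
    by rewrite addnC exprD; move: ((4 * K) ^+ 4) ((4 * K) ^+ j) => p q; ring.
  apply: le_trans XX1 _; rewrite ler_wpM2l ?natb //.
  by rewrite exprn_ge0 // (le_trans ler01 K4).
split=> //.
- by have [] := genF.
- by apply: le_trans A1le; rewrite /Num.max; case: ifP.
exists x0, A1, X'; split=> //.
- exact: (subsetP X1X).
- by split=> //; apply: subset_trans X'X _; exact: dilateS.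
- by rewrite -mulrA.
by rewrite -mulrA.
Qed.

Theorem theoremC (R : realType) :
  exists C k : R, [/\ 0 < C, 0 < k &
    forall (L : finFieldType) (A X : {set L}) (K : R),
      A != set0 -> X != set0 -> 0 \notin A -> 0 \notin X -> 1 <= K ->
      let M := C * ln (#|L|%:R : R) `^ k in
      (M * K ^+ 1505 <= #|X|%:R ->
       \sum_(xi in X) (energy A xi)%:R >= #|A|%:R ^+ 3 * #|X|%:R / K ->
       subspace_structure A X K M 5)
      /\
      (M * K ^+ 1504 <= #|X|%:R ->
       (forall xi : L, xi \in X -> (energy A xi)%:R >= #|A|%:R ^+ 3 / K) ->
       subspace_structure A X K M 4)].
Proof.
have [B B1 main] := subspace_structure_of_nat R.
have ln2 : 0 < ln (2 : R) by rewrite ln_gt0 // ltr1n.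
(* Since a field has at least two elements, ln q >= ln 2 and M >= [B]. *)
exists (B / ln 2), 1; split=> //; first exact: divr_gt0 (lt_le_trans ltr01 B1) ln2.
move=> L A X K A0 X0 _ Xu K1 M.
have BM : B <= M.
  have L1 : (1 < #|L|)%N := card_finNzRing_gt1 L.
  rewrite /M powRr1; last by rewrite ln_ge0 // ler1n ltnW.
  rewrite -mulrA ler_peMr ?(le_trans ler01 B1) // mulrC ler_pdivlMr // mul1r.
  by rewrite ler_ln ?posrE ?ltr0n ?ler_nat // ltnW.
have K0 : 0 < K := lt_le_trans ltr01 K1.
pose k := (Num.truncn K).+1.
have Kk : K <= k%:R := ltW (truncnS_gt K).
have k2K : k%:R <= 2 * K.
  have : (Num.truncn K)%:R <= K by rewrite truncn_le ltW.
  by rewrite /k -natr1; lra.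
split=> hX hE.
  have hE' : (#|X| * #|A| ^ 3 <= k * \sum_(xi in X) energy A xi)%N.
    rewrite -(ler_nat R) natrM natrX natrM natr_sum mulrC.
    move: hE; rewrite ler_pdivrMr // => hE; apply: le_trans hE _.
    by rewrite mulrC ler_wpM2r // sumr_ge0.
  have A3 : (0 < #|A| ^ 3)%N by rewrite expn_gt0 card_gt0 A0.
  have Ele xi : (energy A xi <= #|A| ^ 3)%N.
    rewrite energyE.
    apply: leq_trans (_ : \sum_(p in setX A A) #|A| <= _)%N; last first.
      by rewrite sum_nat_const cardsX mulnn mulnC -expnS.
    apply: leq_sum => p _; rewrite /rep.
    rewrite -(@card_in_imset _ _ snd); last first.
      move=> [a b] [a' b'] /setIdP[_ /eqP e] /setIdP[_ /eqP e'] /= bb.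
      by move: e; rewrite /= bb -e' => /addIr ->.
    apply/subset_leq_card/subsetP => _ /imsetP[[a b] /setIdP[/setXP[_ bA] _] ->].
    exact: bA.
  (* With |A|^3 as trivial upper bound for each energy, a proportion 1 / (2k) of [X] has energy at
     least |A|^3 / (2k), and 2k <= 4K. *)
  have := popular_le A3 (fun xi _ => Ele xi) hE'.
  set X1 := [set xi in X | _] => XX1.
  apply: (main L A X X1 K M (2 * k)%N 1%N) => //.
  - by apply/subsetP => xi /setIdP[].
  - by rewrite natrM; lra.
  - rewrite expr1; move: XX1; rewrite -(ler_nat R) natrM => h; apply: le_trans h _.
    by rewrite ler_wpM2r // natrM; lra.
  by move=> xi /setIdP[].
apply: (main L A X X K M k 0%N) => //.
- by lra.
- by rewrite expr0 mul1r.
move=> xi xiX; have := hE _ xiX; rewrite ler_pdivrMr // => h.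
rewrite -(ler_nat R) natrX natrM; apply: le_trans h _.
by rewrite mulrC ler_wpM2r.
Qed.
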